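(* Let $P$ denote the uniform probability measure (Lebesgue measure) on $[0,1]$. Then for every $T>0$, as $\delta\to 0$ (with $\delta>0$), $$P\left(\left\{x\in[0,1]: \sqrt{\delta}\,q_{\min}(x,\delta)\leq T \right\}\right)\longrightarrow \mu_2\left(\left\{\Lambda\in X_2: F^1_1(\Lambda)\leq T\right\}\right).$$
   Context: For $\delta>0$ and $x\in[0,1]$, the minimal denominator function is $q_{\min}(x,\delta)=\min\{q\in\mathbb{N}: \text{there exists } p\in\mathbb{Z} \text{ such that } \frac{p}{q}\in(x-\delta,x+\delta)\}$, where $\mathbb{N}$ denotes the positive integers. $X_2=SL(2,\mathbb{R})/SL(2,\mathbb{Z})$ is the space of unimodular (covolume one) lattices in $\mathbb{R}^2$, where the coset $g\,SL(2,\mathbb{Z})$ is identified with the lattice $g\mathbb{Z}^2$. $\mu_2$ is the $SL(2,\mathbb{R})$-invariant probability measure on $X_2$ arising from Haar measure on $SL(2,\mathbb{R})$. The function $F^1_1:X_2\to\mathbb{R}$ is $$F^1_1(\Lambda)=\min\left\{u\in\mathbb{R}: \text{there exists } v\in\mathbb{R} \text{ such that } \begin{bmatrix} u \\ v \end{bmatrix}\in\Lambda\cap C_1\right\},$$ where $C_1=\{[x,y]^T\in\mathbb{R}^2: x>0,\ |y|<x\}$. *)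

(* Defs.v *)
From HB Require Import structures.
From mathcomp Require Import all_boot all_order all_algebra.
From mathcomp Require Import all_classical all_reals all_analysis.
From mathcomp Require Import ring lra zify.

Set Implicit Arguments.
Unset Strict Implicit.
Unset Printing Implicit Defensive.

Import Order.TTheory GRing.Theory Num.Theory.
Import numFieldNormedType.Exports.

Local Open Scope classical_set_scope.
Local Open Scope ring_scope.
Local Open Scope quotient_scope.

(* Minimum of a set, i.e. its element that is also a lower bound; the junk
   value [x0] is returned when there is none.  The minima in [qmin] and [F11]
   below do exist, see [qmin_exists] and [F11_exists]. *)
Definition is_min d (T : porderType d) (A : set T) (x : T) : Prop :=
  A x /\ lbound A x.

Definition minimum d (T : porderType d) (x0 : T) (A : set T) : T :=
  xget x0 [set x | is_min A x].

Lemma minimumP d (T : porderType d) (x0 : T) (A : set T) :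
  (exists x, is_min A x) -> is_min A (minimum x0 A).
Proof. exact: xgetPex. Qed.

Section qmin.
Variable R : realType.
Implicit Types x delta : R.

Definition denominators x delta : set nat :=
  [set q | (0 < q)%N /\
     exists p : int, (p%:~R / q%:R : R) \in `]x - delta, x + delta[ ].

Definition qmin x delta : nat := minimum 0%N (denominators x delta).

Lemma qmin_exists x delta : 0 < delta ->
  exists q, is_min (denominators x delta) q.
Proof.
move=> d0; have [q [q0 hq]] : denominators x delta !=set0.
  pose q := (Num.truncn delta^-1).+1.
  have q0 : 0 < q%:R :> R by rewrite ltr0n.
  have hq : 1 / q%:R < delta.
    by rewrite ltr_pdivrMr// mulrC -ltr_pdivrMr// mul1r; exact: truncnS_gt.
  exists q; split=> //; exists (Num.floor (x * q%:R)).
  have := floor_le (x * q%:R); have := floorD1_gt (x * q%:R).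
  rewrite intrD -ltr_pdivlMr// mulrDl => h1; rewrite -ler_pdivrMr// => h2.
  by rewrite in_itv /=; apply/andP; split; lra.
have ex : exists q, `[< denominators x delta q >].
  by exists q; apply/asboolP; split.
exists (ex_minn ex); case: ex_minnP => m /asboolP hm mP; split=> // k hk.
by rewrite leEnat; apply: mP; apply/asboolP.
Qed.

End qmin.

Section SL2.
Variable R : realType.

Definition SL2 : Type := set_type [set g : 'M[R]_2 | \det g = 1].

HB.instance Definition _ := Topological.copy SL2
  (set_type [set g : 'M[R]_2 | \det g = 1]).

Definition mkSL2 (g : 'M[R]_2) (dg : \det g = 1) : SL2 :=
  exist _ g (mem_set dg).

Lemma det_SL2 (g : SL2) : \det (val g) = 1.
Proof. by case: g => g /= /set_mem. Qed.

Definition SL2_one : SL2 := mkSL2 (det1 R 2).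

Fact SL2_mul_subproof (g h : SL2) : \det (val g *m val h) = 1.
Proof. by rewrite det_mulmx !det_SL2 mulr1. Qed.

Definition SL2_mul (g h : SL2) : SL2 := mkSL2 (SL2_mul_subproof g h).

HB.instance Definition _ := isPointed.Build SL2 SL2_one.

Definition SL2Z : set SL2 :=
  [set g | exists2 c : 'M[int]_2, \det c = 1 & val g = map_mx intr c].

Definition coset_rel (g h : SL2) : bool :=
  `[< exists2 c, SL2Z c & h = SL2_mul g c >].

Fact coset_rel_refl : reflexive coset_rel.
Proof.
move=> g; apply/asboolP; exists SL2_one; first by exists 1%:M;
  rewrite ?det1// map_mx1.
by apply/val_inj; rewrite /= mulmx1.
Qed.

Fact coset_rel_trans : transitive coset_rel.
Proof.
move=> h g k /asboolP[c [c' dc cE] ->] /asboolP[d [d' dd dE] ->].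
apply/asboolP; exists (SL2_mul c d); last by apply/val_inj; rewrite /= mulmxA.
exists (c' *m d'); first by rewrite det_mulmx dc dd mulr1.
by rewrite /= cE dE map_mxM.
Qed.

Fact coset_rel_sym : symmetric coset_rel.
Proof.
suff sub g h : coset_rel g h -> coset_rel h g.
  by move=> g h; apply/idP/idP; exact: sub.
move=> /asboolP[c [c' dc cE] ->]; apply/asboolP.
have da : \det (\adj c') = 1.
  by have := congr1 determinant (mul_mx_adj c'); rewrite dc det_mulmx dc mul1r det1.
have da' : \det (map_mx intr (\adj c') : 'M[R]_2) = 1.
  by rewrite det_map_mx da.
exists (mkSL2 da'); first by exists (\adj c').
by apply/val_inj; rewrite /= -mulmxA cE -map_mxM mul_mx_adj dc map_mx1 mulmx1.
Qed.

Canonical coset_equiv : equiv_rel SL2 :=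
  EquivRel coset_rel coset_rel_refl coset_rel_sym coset_rel_trans.

Definition X2 : Type := quotient_topology {eq_quot coset_rel}.

HB.instance Definition _ := Topological.on X2.
HB.instance Definition _ := Pointed.on X2.
HB.instance Definition _ := Quotient.on X2.

Definition borelX2 : Type := g_sigma_algebraType (@open X2).

HB.instance Definition _ := Measurable.on borelX2.

(* By [actX2_pi] this is g . (h SL(2,Z)) = (g h) SL(2,Z). *)
Definition actX2 (g : SL2) (L : X2) : X2 := \pi_X2 (SL2_mul g (repr L)).

Lemma pi_X2_eq (g h : SL2) :
  \pi_X2 g = \pi_X2 h <-> exists2 c, SL2Z c & h = SL2_mul g c.
Proof.
split=> [/eqmodP/asboolP //|H].
by apply/eqmodP/asboolP.
Qed.

Lemma actX2_pi g h : actX2 g (\pi_X2 h) = \pi_X2 (SL2_mul g h).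
Proof.
have /pi_X2_eq[c Zc hE] : \pi_X2 (repr (\pi_X2 h)) = \pi_X2 h by rewrite reprK.
apply/pi_X2_eq; exists c => //.
by rewrite {1}hE; apply/val_inj; rewrite /= mulmxA.
Qed.

(* A probability measure on X2 with this property is unique: it is the one
   induced by a Haar measure on SL(2,R). *)
Definition SL2_invariant (mu : set borelX2 -> \bar R) : Prop :=
  forall (g : SL2) (A : set borelX2), measurable A ->
    mu (actX2 g @^-1` A) = mu A.

(* The lattice g Z^2 of the coset g SL(2,Z); by [lattice_pi] it does not depend
   on the representative. *)
Definition lattice (L : X2) : set 'cV[R]_2 :=
  [set val (repr L) *m map_mx intr z | z in [set: 'cV[int]_2]].

Lemma lattice_pi (g : SL2) :
  lattice (\pi_X2 g) = [set val g *m map_mx intr z | z in [set: 'cV[int]_2]].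
Proof.
have sub (h k : SL2) : (exists2 c, SL2Z c & k = SL2_mul h c) ->
  [set val k *m map_mx intr z | z in [set: 'cV[int]_2]] `<=`
  [set val h *m map_mx intr z | z in [set: 'cV[int]_2]].
  move=> [c [c' _ cE] ->] _ [z _ <-]; exists (c' *m z) => //.
  by rewrite map_mxM /= cE mulmxA.
apply/seteqP; split; apply: sub; apply/pi_X2_eq; by rewrite reprK.
Qed.

Definition vec2 (u v : R) : 'cV[R]_2 := \col_(i < 2) (if i == 0 then u else v).

Definition C1 : set 'cV[R]_2 := [set w | 0 < w 0 0 /\ `|w 1 0| < w 0 0].

Definition F11 (L : X2) : R :=
  minimum 0 [set u | exists v, (lattice L `&` C1) (vec2 u v)].

End SL2.

Fact mulmx_vec2 (R : realType) (g : 'M[R]_2) (w : 'cV[R]_2) :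
  g *m w = vec2 (g 0 0 * w 0 0 + g 0 1 * w 1 0)
                (g 1 0 * w 0 0 + g 1 1 * w 1 0).
Proof.
have l1 : lift ord0 ord0 = 1 :> 'I_2 by apply/val_inj.
apply/matrixP => i j; rewrite !mxE !big_ord_recl big_ord0 addr0 l1.
have -> : j = 0 by apply/val_inj; case: j => [[]].
by case: i => [[|[|//]] hi] /=; congr (g _ _ * _ + g _ _ * _); apply/val_inj.
Qed.

Fact det_mx22 (R : realType) (g : 'M[R]_2) :
  \det g = g 0 0 * g 1 1 - g 0 1 * g 1 0.
Proof.
have l1 : lift ord0 ord0 = 1 :> 'I_2 by apply/val_inj.
have l2 : lift 1 0 = 0 :> 'I_2 by apply/val_inj.
rewrite (expand_det_row _ 0) !big_ord_recl big_ord0 addr0 l1.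
rewrite /cofactor !det_mx11 !mxE /= l1 l2 expr0 expr1 mul1r mulN1r.
by rewrite mulrN.
Qed.

Lemma F11_exists (R : realType) (L : X2 R) :
  exists u, is_min [set u | exists v, (lattice L `&` @C1 R) (vec2 u v)] u.
Proof.
have := det_SL2 (repr L); rewrite /lattice; move: (val (repr L)) => g.
rewrite det_mx22.
set a := g 0 0; set b := g 0 1; set c := g 1 0; set d := g 1 1 => dg.
pose X (m n : int) : R := a * m%:~R + b * n%:~R.
pose Y (m n : int) : R := c * m%:~R + d * n%:~R.
pose P m n := (0 < X m n) && (`|Y m n| < X m n).
have AE u : (exists v, ([set g *m map_mx intr z | z in [set: 'cV[int]_2]]
    `&` @C1 R) (vec2 u v)) <-> exists m n, P m n /\ X m n = u.
  split=> [[v [[z _]]]|[m [n [/andP[h1 h2] <-]]]].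
    rewrite mulmx_vec2 !mxE => zE [h1 h2].
    have uE : X (z 0 0) (z 1 0) = u.
      by have := congr1 (fun w : 'cV_2 => w 0 0) zE; rewrite !mxE.
    have vE : Y (z 0 0) (z 1 0) = v.
      by have := congr1 (fun w : 'cV_2 => w 1 0) zE; rewrite !mxE.
    exists (z 0 0), (z 1 0); split=> //; rewrite /P uE vE.
    by move: h1 h2; rewrite !mxE /= => -> ->.
  exists (Y m n); split; last by split; rewrite !mxE.
  exists (\col_i if i == 0 then m else n) => //.
  by rewrite mulmx_vec2 !mxE.
pose S := `|a| + `|b| + `|c| + `|d|.
have [m0 [n0 P0]] : exists m n, P m n.
  pose t := 2 * S + 1.
  pose m := Num.floor (t * d); pose n := Num.floor (- (t * c)).
  have hm : `|t * d - m%:~R| <= 1.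
    have := floor_le (t * d); have := floorD1_gt (t * d).
    by rewrite intrD ler_norml -/m; lra.
  have hn : `|- (t * c) - n%:~R| <= 1.
    have := floor_le (- (t * c)); have := floorD1_gt (- (t * c)).
    by rewrite intrD ler_norml -/n; lra.
  have XE : X m n = t - (a * (t * d - m%:~R) + b * (- (t * c) - n%:~R)).
    transitivity (t * (a * d - b * c) - (a * (t * d - m%:~R) + b * (- (t * c) - n%:~R))); last by rewrite dg mulr1.
    by rewrite /X; ring.
  have YE : Y m n = - (c * (t * d - m%:~R) + d * (- (t * c) - n%:~R)).
    by rewrite /Y; ring.
  have bd (p q r s : R) : `|r| <= 1 -> `|s| <= 1 -> `|p * r + q * s| <= `|p| + `|q|.
    move=> hr hs; apply: (le_trans (ler_normD _ _)); rewrite !normrM.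
    by apply: lerD; rewrite ler_piMr.
  have := bd a b _ _ hm hn; have := bd c d _ _ hm hn.
  rewrite !ler_norml => /andP[y1 y2] /andP[x1 x2].
  have := (normr_ge0 a, normr_ge0 b, normr_ge0 c, normr_ge0 d) => -[[[a0 b0] c0] d0].
  move: x1 x2 y1 y2; set e1 := a * _ + _ in XE *; set e2 := c * _ + _ in YE *.
  move=> x1 x2 y1 y2; exists m, n.
  by apply/andP; rewrite ltr_norml XE YE; split; rewrite /t /S; lra.
pose u0 := X m0 n0; have u00 : 0 < u0 by case/andP: P0.
pose K := (Num.truncn (u0 * S)).+1.
have KP m n : P m n -> X m n <= u0 -> (`|m| < K)%N /\ (`|n| < K)%N.
  case/andP=> hX; rewrite ltr_norml => /andP[y1 y2] Xu.
  have mE : m%:~R = d * X m n - b * Y m n.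
    transitivity ((a * d - b * c) * m%:~R); first by rewrite dg mul1r.
    by rewrite /X /Y; ring.
  have nE : n%:~R = a * Y m n - c * X m n.
    transitivity ((a * d - b * c) * n%:~R); first by rewrite dg mul1r.
    by rewrite /X /Y; ring.
  have hYn : `|Y m n| <= u0 by rewrite ler_norml; lra.
  have hXn : `|X m n| <= u0 by rewrite ler_norml; lra.
  have bd (p q r s : R) : `|r| <= u0 -> `|s| <= u0 ->
      `|p * r - q * s| <= u0 * (`|p| + `|q|).
    move=> hr hs; apply: (le_trans (ler_normB _ _)); rewrite !normrM mulrDr.
    by apply: lerD; rewrite mulrC ler_wpM2r.
  have fin (k : int) : `|k%:~R : R| <= u0 * S -> (`|k| < K)%N.
    move=> hk; rewrite -(ltr_nat R) natr_absz intr_norm.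
    exact: (le_lt_trans hk (truncnS_gt _)).
  have := (normr_ge0 a, normr_ge0 b, normr_ge0 c, normr_ge0 d) => -[[[a0 b0] c0] d0].
  have u0S p q : `|p| + `|q| <= S -> u0 * (`|p| + `|q|) <= u0 * S.
    by move=> h; rewrite ler_wpM2l// ltW.
  split; apply: fin; rewrite ?mE ?nE.
    apply: (le_trans (bd _ _ _ _ hXn hYn)); apply: u0S; rewrite /S; lra.
  apply: (le_trans (bd _ _ _ _ hYn hXn)); apply: u0S; rewrite /S; lra.
pose I := 'I_(K + K); pose z (i : I) : int := i%:Z - K%:Z.
have zP k : (`|k| < K)%N -> exists i : I, z i = k.
  move=> hk; have hi : (absz (k + K%:Z)%R < K + K)%N by lia.
  by exists (Ordinal hi); rewrite /z /=; lia.
have [i0 i0E] := zP _ (KP _ _ P0 (lexx _)).1.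
have [j0 j0E] := zP _ (KP _ _ P0 (lexx _)).2.
pose Q (p : I * I) := P (z p.1) (z p.2).
have Q0 : Q (i0, j0) by rewrite /Q /= i0E j0E.
case: (@arg_minP _ _ _ (i0, j0) Q (fun p => X (z p.1) (z p.2)) Q0).
move=> p Qp pmin; exists (X (z p.1) (z p.2)).
split; first by apply/AE; exists (z p.1), (z p.2).
move=> u /AE[m [n [Pmn <-]]].
have := pmin _ Q0; rewrite /= i0E j0E => pu0.
have [hu|/ltW hu] := leP (X m n) u0; last exact: le_trans pu0 hu.
have [/zP[i iE] /zP[j jE]] := KP _ _ Pmn hu.
by have := pmin (i, j); rewrite /Q /= iE jE; apply.
Qed.

(* Main.v *)
Require Import Defs.
From HB Require Import structures.
From mathcomp Require Import all_boot all_order all_algebra.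
From mathcomp Require Import all_classical all_reals all_analysis.
From mathcomp Require Import measurable_realfun.
From mathcomp Require Import ring lra zify.

Set Implicit Arguments.
Unset Strict Implicit.
Unset Printing Implicit Defensive.

Import Order.TTheory GRing.Theory Num.Theory.
Import numFieldNormedType.Exports.

Local Open Scope classical_set_scope.
Local Open Scope ring_scope.

(* Call a basis of a lattice a Farey basis if its vectors are successive, by
   slope, in the strip 0 < x <= T, the first being in C1 and the second above it.
   A lattice with F11 <= T has exactly one Farey basis, the others have none.
   Let m(T) = mu2 (F11 <= T) and G(T) the integral of min(2, 1/(x x')) over the
   triangle 0 < x, x' <= T < x + x'.  Integrate over a in SL(2,R), for a Haar
   measure, the mu2-measure of the lattices whose Farey basis for T is sent by a
   to a Farey basis for T': by Fubini this is m(T) G(T'), and it is symmetric in T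
   and T' by invariance under a |-> a^-1; hence m is proportional to G.
   On the other hand, with h = sqrt delta, the set of x with h qmin(x,delta) <= T
   is, up to a set of measure O(delta), the disjoint union over coprime (q, r) of
   intervals of length h^2 min(2, 1/(h q h r)), (h q, h r) in the triangle.  Sorting
   the pairs (q, r) by their gcd, the convergence of Riemann sums to G(T) gives
   that of the measures to G(T)/zeta(2).  By Dirichlet's approximation theorem
   G(T)/zeta(2) -> 1 as T -> oo, and m(T) -> 1, so that m(T) = G(T)/zeta(2). *)

(** All that is known of [mu2] is that it is an invariant probability measure: no fundamental domain
    is there to integrate over. Averaging over the group replaces one. Since a Farey basis singles
    out one basis of each lattice with [F11] <= T, a condition on that basis becomes a condition on
    a matrix of SL(2,R), whose Haar integral does not depend on the lattice by right invariance.
    This gives the law of [F11] up to a factor, which has to be found by comparing total masses.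
    That comparison is legitimate only if the limit delta -> 0 loses no mass at T = oo; Dirichlet's
    theorem excludes this through the bound 16/T^2, uniform in h <= T/2. Thus zeta(2) is never
    related to a covolume: it enters only through the sorting of integer pairs by their gcd. *)

(** * Lattice vectors in a box, lattice bases in the strip 0 < x <= T *)

Lemma finite_set_argmax (T : choiceType) (R : realDomainType) (A : set T) (f : T -> R) :
  finite_set A -> A !=set0 -> exists2 x, A x & forall y, A y -> f y <= f x.
Proof.
move=> /finite_seqP[s ->]; elim: s => [[x]//|x s IH _].
have [s0|/set0P/IH[y ys ymax]] := eqVneq [set` s] set0.
  exists x => [|y]; rewrite /= ?mem_head// inE => /orP[/eqP->//|ys].
  by have : [set` s] y by []; rewrite s0.
have [xy|yx] := leP (f x) (f y).
  exists y; first by rewrite /= inE [_ \in _]ys orbT.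
  by move=> z; rewrite /= inE => /orP[/eqP->//|/ymax].
exists x; first by rewrite /= mem_head.
move=> z; rewrite /= inE => /orP[/eqP->//|/ymax h].
exact: le_trans h (ltW yx).
Qed.

Lemma finite_int_ball (K : nat) : finite_set [set i : int | (`|i| <= K)%N].
Proof.
apply: (@sub_finite_set _ _ ((fun j : nat => j%:Z - K%:Z) @` `I_(K + K).+1)).
  move=> i /= iK; exists (absz (i + K%:Z)%R); last by lia.
  by rewrite /=; lia.
exact/finite_image/finite_II.
Qed.

Section unimodular.
Variables (R : realType) (a b c d : R).
Hypothesis det1 : a * d - b * c = 1.

Let X (z : int * int) : R := a * z.1%:~R + b * z.2%:~R.
Let Y (z : int * int) : R := c * z.1%:~R + d * z.2%:~R.

(** By Cramer's rule the inverse matrix has entries d, -b, -c, a, so the integer coordinates are at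
    most A S in absolute value. *)
Lemma finite_lattice_box (A : R) :
  finite_set [set z | `|X z| <= A /\ `|Y z| <= A].
Proof.
have [A0|A0] := ltP A 0.
  rewrite [X in finite_set X](_ : _ = set0)//; apply/seteqP; split=> // z [h _].
  by have := le_lt_trans (le_trans (normr_ge0 _) h) A0; rewrite ltxx.
pose S := `|a| + `|b| + `|c| + `|d|; pose K := (Num.truncn (A * S)).+1.
apply: (@sub_finite_set _ _ ([set i : int | (`|i| <= K)%N] `*` [set i : int | (`|i| <= K)%N])); last first.
  by apply: finite_setX; exact: finite_int_ball.
move=> z [hX hY].
have bd (p q r s : R) : `|p| + `|q| <= S -> `|r| <= A -> `|s| <= A -> `|p * r - q * s| <= A * S.
  move=> pq hr hs; apply: (le_trans (ler_normB _ _)); rewrite !normrM.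
  apply: (@le_trans _ _ (A * (`|p| + `|q|))); last by rewrite ler_wpM2l.
  by rewrite mulrDr; apply: lerD; rewrite mulrC ler_wpM2r.
have fin (k : int) : `|k%:~R : R| <= A * S -> (`|k| <= K)%N.
  move=> hk; apply: ltnW; rewrite -(ltr_nat R) natr_absz intr_norm.
  exact: (le_lt_trans hk (truncnS_gt _)).
have := (normr_ge0 a, normr_ge0 b, normr_ge0 c, normr_ge0 d) => -[[[a0 b0] c0] d0].
have mE : z.1%:~R = d * X z - b * Y z.
  transitivity ((a * d - b * c) * z.1%:~R); first by rewrite det1 mul1r.
  by rewrite /X /Y; ring.
have nE : z.2%:~R = a * Y z - c * X z.
  transitivity ((a * d - b * c) * z.2%:~R); first by rewrite det1 mul1r.
  by rewrite /X /Y; ring.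
split; apply: fin; rewrite ?mE ?nE; apply: bd => //; rewrite /S; lra.
Qed.

(* Among the lattice vectors of the strip with slope in [sigma, tau[, take one
   of maximal slope and shortest; the basis vector following it in the strip
   has larger slope, hence slope at least tau. *)
Lemma exists_next_basis (T sigma tau : R) (z : int * int) :
  0 < X z <= T -> sigma * X z <= Y z < tau * X z ->
  exists u v : int * int, [/\ u.1 * v.2 - v.1 * u.2 = 1, 0 < X u <= T, 0 < X v <= T,
    T < X u + X v & sigma * X u <= Y u < tau * X u /\ tau * X v <= Y v].
Proof.
move=> zT zs.
pose B := [set z | 0 < X z <= T /\ sigma * X z <= Y z < tau * X z].
have finB : finite_set B.
  pose A := T * (`|sigma| + `|tau| + 1).
  apply: (sub_finite_set _ (finite_lattice_box A)) => w [/andP[w0 wT] /andP[ws wt]].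
  have T0 : 0 < T by exact: lt_le_trans wT.
  have st0 := (normr_ge0 sigma, normr_ge0 tau).
  split; rewrite ler_norml /A.
    have : 0 <= T * (`|sigma| + `|tau|) by apply: mulr_ge0; [exact: ltW|exact: addr_ge0].
    by move=> h; rewrite mulrDr mulr1; apply/andP; split; lra.
  have s1 : `|sigma * X w| <= T * `|sigma|.
    by rewrite normrM (gtr0_norm w0) mulrC ler_wpM2r.
  have s2 : `|tau * X w| <= T * `|tau|.
    by rewrite normrM (gtr0_norm w0) mulrC ler_wpM2r.
  have h1 : 0 <= T * `|tau| by rewrite mulr_ge0 // ltW.
  have h2 : 0 <= T * `|sigma| by rewrite mulr_ge0 // ltW.
  have -> : T * (`|sigma| + `|tau| + 1) = T * `|sigma| + T * `|tau| + T by ring.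
  move: s1 s2; rewrite !ler_norml => /andP[s1 s1'] /andP[s2 s2'].
  by apply/andP; split; lra.
have [u0 [/andP[u00 u0T] /andP[u0s u0t]] u0max] :=
  @finite_set_argmax _ _ _ (fun z => Y z / X z) finB (ex_intro _ z (conj zT zs)).
pose g := gcdz u0.1 u0.2.
have g0 : 0 < g.
  rewrite lt_def [_ <= _]isT andbT gcdz_eq0; apply/negP => /andP[/eqP h1 /eqP h2].
  by move: u00; rewrite /X h1 h2 !mulr0 addr0 ltxx.
(* Maximality fixes only the slope of [u0]. The primitive vector [u] on the same ray has this slope
   too, is still in the strip, and extends to a basis. *)
pose u : int * int := ((u0.1 %/ g)%Z, (u0.2 %/ g)%Z).
have uE1 : u0.1 = u.1 * g by rewrite /u/= divzK// dvdz_gcdl.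
have uE2 : u0.2 = u.2 * g by rewrite /u/= divzK// dvdz_gcdr.
have gR1 : 1 <= g%:~R :> R by rewrite (ler_int R 1).
have gR0 : 0 < g%:~R :> R by exact: lt_le_trans gR1.
have XE : X u0 = X u * g%:~R by rewrite /X uE1 uE2 !intrM; ring.
have YE : Y u0 = Y u * g%:~R by rewrite /Y uE1 uE2 !intrM; ring.
have Xu0 : 0 < X u by move: u00; rewrite XE pmulr_lgt0.
have XuT : X u <= T by apply: le_trans u0T; rewrite XE ler_peMr// ltW.
have Yus : sigma * X u <= Y u.
  by move: u0s; rewrite XE YE mulrA ler_pM2r.
have Yut : Y u < tau * X u.
  by move: u0t; rewrite XE YE mulrA ltr_pM2r.
have umax w : B w -> Y w / X w <= Y u / X u.
  by move=> /u0max; rewrite XE YE -mulf_div divff ?gt_eqF// mulr1.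
have [p [q pq]] := Bezoutz u0.1 u0.2.
have {}pq : p * u.1 + q * u.2 = 1.
  apply: (mulIf (lt0r_neq0 g0)); rewrite mul1r mulrDl -!mulrA -uE1 -uE2.
  exact: pq.
(* The vectors completing [u] to a basis of determinant 1 form the coset (-q, p) + Z u; [k] picks
   the one whose X lies in ]T - X u, T]. *)
pose k := Num.floor ((T - X (- q, p)) / X u).
pose v : int * int := (- q + k * u.1, p + k * u.2).
have uv1 : u.1 * v.2 - v.1 * u.2 = 1 by rewrite /v/= -pq; ring.
have XvE : X v = X (- q, p) + k%:~R * X u by rewrite /X/= !intrD !intrM; ring.
have XvT : X v <= T.
  by rewrite XvE -lerBrDl -ler_pdivlMr//; exact: floor_le.
have Xuv : T < X u + X v.
  have := floorD1_gt ((T - X (- q, p)) / X u); rewrite ltr_pdivrMr// intrD -/k.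
  by rewrite XvE mulrDl mul1r; lra.
have Xv0 : 0 < X v by lra.
have duv : X u * Y v - X v * Y u = 1.
  transitivity ((a * d - b * c) * (u.1 * v.2 - v.1 * u.2)%:~R).
    by rewrite intrD intrN !intrM /X /Y; ring.
  by rewrite det1 uv1 mul1r.
exists u, v; split; rewrite ?Xu0 ?XuT ?Xv0 ?XvT//; split; first by apply/andP.
(* As the determinant is 1, the slope of [v] exceeds that of [u], hence sigma; if it were below tau,
   [v] would contradict the maximality of [u]. *)
rewrite leNgt; apply/negP => Yvt.
have Bv : B v.
  split; first by rewrite Xv0.
  rewrite Yvt andbT -(ler_pM2l Xu0).
  have : X v * (sigma * X u) <= X v * Y u by rewrite ler_pM2l.
  have -> : X u * (sigma * X v) = X v * (sigma * X u) by ring.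
  by move: duv; set p1 := X u * Y v; set p2 := X v * Y u; set p3 := X v * _; lra.
have := umax _ Bv; rewrite ler_pdivrMr// mulrAC ler_pdivlMr// mulrC (mulrC (Y u)).
by move: duv; set p1 := X u * Y v; set p2 := X v * Y u; lra.
Qed.

End unimodular.

(** * Farey bases: uniqueness, existence, relation with [F11] *)

Lemma mulmx22 (R : pzRingType) (A B : 'M[R]_2) i j :
  (A *m B) i j = A i 0 * B 0 j + A i 1 * B 1 j.
Proof.
rewrite mxE !big_ord_recl big_ord0 addr0.
by have -> : lift ord0 ord0 = 1 :> 'I_2 by apply/val_inj.
Qed.

Lemma det_intmx22 (c : 'M[int]_2) :
  \det c = c 0 0 * c 1 1 - c 0 1 * c 1 0.
Proof.
have l1 : lift ord0 ord0 = 1 :> 'I_2 by apply/val_inj.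
have l2 : lift 1 0 = 0 :> 'I_2 by apply/val_inj.
rewrite (expand_det_row _ 0) !big_ord_recl big_ord0 addr0 l1.
rewrite /cofactor !det_mx11 !mxE /= l1 l2 expr0 expr1 mul1r mulN1r.
by rewrite mulrN.
Qed.

Lemma ord2P (k : 'I_2) : k = 0 \/ k = 1.
Proof. by case: k => [[|[|//]] hk]; [left|right]; apply/val_inj. Qed.

Lemma matrix22P (R : Type) (A B : 'M[R]_2) :
  A 0 0 = B 0 0 -> A 0 1 = B 0 1 -> A 1 0 = B 1 0 -> A 1 1 = B 1 1 -> A = B.
Proof.
move=> h00 h01 h10 h11; apply/matrixP => i j.
by case: (ord2P i) => ->; case: (ord2P j) => ->.
Qed.

Section farey.
Variable R : realType.
Implicit Types (m : 'M[R]_2) (T : R) (c : 'M[int]_2).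

(* The columns of [m] are successive, by slope, among the vectors of the lattice
   they span lying in the strip 0 < x <= T; the first one lies in the cone C1,
   the second one above it. *)
Definition farey T m : Prop :=
  [/\ 0 < m 0 0 <= T, 0 < m 0 1 <= T, T < m 0 0 + m 0 1,
      `|m 1 0| < m 0 0 & m 0 1 <= m 1 1].

(** Here (p, q) is a vector with p <= T and slope condition q < p. If j >= 1, then either i >= 1 and
    p >= x + x' > T, or i <= 0 and the form q - p, negative on the first basis vector and
    nonnegative on the second, is nonnegative on (p, q). *)
Lemma farey_coef_le0 T (x x' y y' p q : R) (i j : int) :
  0 < x -> 0 < x' -> T < x + x' -> y < x -> x' <= y' ->
  p <= T -> q < p -> p = x * i%:~R + x' * j%:~R -> q = y * i%:~R + y' * j%:~R ->
  j <= 0.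
Proof.
move=> x0 x'0 xxT yx xy' pT qp pE qE; rewrite leNgt; apply/negP => j0.
have j1 : 1 <= j%:~R :> R by rewrite (ler_int R 1).
have [i1|i0] := leP 1 i.
  have {}i1 : 1 <= i%:~R :> R by rewrite (ler_int R 1).
  have : x * 1 <= x * i%:~R by rewrite ler_pM2l.
  have : x' * 1 <= x' * j%:~R by rewrite ler_pM2l.
  lra.
have {}i0 : i%:~R <= 0 :> R by rewrite (ler_int R _ 0); lia.
have : (x - y) * i%:~R <= 0 by rewrite mulr_ge0_le0// subr_ge0 ltW.
have : 0 <= (y' - x') * j%:~R by rewrite mulr_ge0 ?subr_ge0// ltW// (lt_le_trans _ j1).
rewrite !mulrBl; lra.
Qed.

(** The inverse of c has first column (c 1 1, - c 1 0), so [farey_coef_le0] applied in both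
    directions makes c upper triangular. Positivity makes its diagonal 1, and both second vectors
    have their first coordinate in ]T - x, T], an interval too short for a shift by a nonzero
    multiple of x. *)
Lemma farey_uniq T m c : \det c = 1 ->
  farey T m -> farey T (m *m map_mx intr c) -> c = 1%:M.
Proof.
rewrite det_intmx22 => dc [/andP[x0 xT] /andP[x'0 x'T] xx y y'].
rewrite /farey !mulmx22 !mxE => -[/andP[p0 pT] /andP[p'0 p'T] pp q q'].
have /andP[yl yr] : - m 0 0 < m 1 0 < m 0 0 by rewrite -ltr_norml.
move: (q); rewrite ltr_norml => /andP[ql qr].
have j0 := farey_coef_le0 x0 x'0 xx yr y' pT qr erefl erefl.
have dR : (c 0 0)%:~R * (c 1 1)%:~R - (c 0 1)%:~R * (c 1 0)%:~R = 1 :> R.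
  by rewrite -!intrM -intrB dc.
have k0 : - c 1 0 <= 0.
  apply: (@farey_coef_le0 T _ _ _ _ (m 0 0) (m 1 0) (c 1 1) (- c 1 0) p0 p'0 pp qr q' xT yr).
    transitivity (m 0 0 * ((c 0 0)%:~R * (c 1 1)%:~R - (c 0 1)%:~R * (c 1 0)%:~R)).
      by rewrite dR mulr1.
    by rewrite mulrNz; ring.
  transitivity (m 1 0 * ((c 0 0)%:~R * (c 1 1)%:~R - (c 0 1)%:~R * (c 1 0)%:~R)).
    by rewrite dR mulr1.
  by rewrite mulrNz; ring.
have c10 : c 1 0 = 0 by apply/eqP; rewrite eq_le j0 -oppr_le0.
rewrite c10 mulr0 subr0 in dc.
have c00 : c 0 0 = 1.
  have c00_gt0 : 0 < c 0 0.
    by move: p0; rewrite c10 mulr0 addr0 pmulr_rgt0// ltr0z.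
  have c11_gt0 : 0 < c 1 1 by rewrite -(pmulr_rgt0 _ c00_gt0) dc.
  have : c 0 0 * 1 <= c 0 0 * c 1 1 by rewrite ler_pM2l.
  by rewrite dc mulr1; move: c00_gt0; clear; lia.
have c11 : c 1 1 = 1 by move: dc; rewrite c00 mul1r.
have c01 : c 0 1 = 0.
  apply/eqP; rewrite eq_le; move: p'0 p'T pp; rewrite c10 c00 c11 !mulr0 !mulr1 !addr0.
  move=> p'0 p'T pp; apply/andP; split; rewrite leNgt; apply/negP => h.
    have h1 : 1 <= (c 0 1)%:~R :> R by rewrite (ler_int R 1) -gtz0_ge1.
    have : m 0 0 * 1 <= m 0 0 * (c 0 1)%:~R by rewrite ler_pM2l.
    lra.
  have h1 : (c 0 1)%:~R <= -1 :> R by rewrite (ler_int R _ (-1)); move: h; clear; lia.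
  have : m 0 0 * (c 0 1)%:~R <= m 0 0 * -1 by rewrite ler_pM2l.
  lra.
by apply: matrix22P; rewrite !mxE.
Qed.

Lemma farey_basis_uniq T m c c' : \det c = 1 -> \det c' = 1 ->
  farey T (m *m map_mx intr c) -> farey T (m *m map_mx intr c') -> c = c'.
Proof.
move=> dc dc' Tc Tc'.
have da : \det (\adj c) = 1.
  by have := congr1 determinant (mul_mx_adj c); rewrite dc det_mulmx dc mul1r det1.
have c'E : c *m (\adj c *m c') = c' by rewrite mulmxA mul_mx_adj dc mul1mx.
have := @farey_uniq T (m *m map_mx intr c) (\adj c *m c').
rewrite det_mulmx da dc' mul1r -mulmxA -map_mxM c'E => /(_ erefl Tc Tc') E.
by rewrite -c'E E mulmx1.
Qed.

(** The lower bound sigma of [exists_next_basis] is not strict, whereas C1 excludes the slope -1; so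
    sigma is the slope Y / X > -1 of the given vector, and tau is 1. *)
Lemma farey_exists T m (u : int * int) : \det m = 1 ->
  0 < m 0 0 * u.1%:~R + m 0 1 * u.2%:~R <= T ->
  `|m 1 0 * u.1%:~R + m 1 1 * u.2%:~R| < m 0 0 * u.1%:~R + m 0 1 * u.2%:~R ->
  exists2 c, \det c = 1 & farey T (m *m map_mx intr c).
Proof.
rewrite det_mx22 => dm; set X := _ + _; set Y := _ + _ => XT YX.
have [/andP[X0 _]] := XT.
have /andP[Yl Yr] : -X < Y < X by rewrite -ltr_norml.
have [|v [w [vw vT wT Tvw [/andP[vl vr] wl]]]] :=
    @exists_next_basis R _ _ _ _ dm T (Y / X) 1 u XT.
  by rewrite -/X -/Y divfK ?gt_eqF// lexx mul1r.
exists (\matrix_(i, j) if i == 0 then if j == 0 then v.1 else w.1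
                       else if j == 0 then v.2 else w.2).
  by rewrite det_intmx22 !mxE.
rewrite /farey !mulmx22 !mxE /=; split=> //; last by move: wl; rewrite mul1r.
move: vr; rewrite mul1r ltr_norml => ->; rewrite andbT.
apply: lt_le_trans vl; rewrite -mulN1r ltr_pM2r; last by case/andP: vT.
by rewrite ltr_pdivlMr// mulN1r.
Qed.

Lemma farey_vec T m c : farey T (m *m map_mx intr c) -> exists u : int * int,
  0 < m 0 0 * u.1%:~R + m 0 1 * u.2%:~R <= T /\
  `|m 1 0 * u.1%:~R + m 1 1 * u.2%:~R| < m 0 0 * u.1%:~R + m 0 1 * u.2%:~R.
Proof.
rewrite /farey !mulmx22 !mxE => -[xT _ _ yx _].
by exists (c 0 0, c 1 0).
Qed.

Local Open Scope quotient_scope.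

Lemma F11P (g : SL2 R) (u0 := F11 (\pi_(X2 R) g)) :
  let X (z : int * int) := val g 0 0 * z.1%:~R + val g 0 1 * z.2%:~R in
  let Y (z : int * int) := val g 1 0 * z.1%:~R + val g 1 1 * z.2%:~R in
  (exists z, X z = u0 /\ `|Y z| < X z) /\
  (forall z, `|Y z| < X z -> u0 <= X z).
Proof.
move=> X Y.
have [[v [uvL [u0_gt0 v_lt]]] lbu] := minimumP 0 (F11_exists (\pi_(X2 R) g)).
rewrite -/(F11 _) -/u0 in uvL u0_gt0 v_lt lbu.
split.
  move: uvL; rewrite lattice_pi => -[z _]; rewrite mulmx_vec2 !mxE => zE.
  have uE := congr1 (fun w : 'cV_2 => w 0 0) zE.
  have vE := congr1 (fun w : 'cV_2 => w 1 0) zE.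
  rewrite !mxE /= in uE vE; exists (z 0 0, z 1 0).
  by move: v_lt; rewrite !mxE /= /X /Y /= uE vE.
move=> z Yz; apply: lbu; exists (Y z); split; last first.
  by split; rewrite !mxE//=; apply: le_lt_trans Yz.
rewrite lattice_pi; exists (\col_i if i == 0 then z.1 else z.2) => //.
by rewrite mulmx_vec2 !mxE.
Qed.

Lemma F11_le T (g : SL2 R) : F11 (\pi_(X2 R) g) <= T <->
  exists2 c, \det c = 1 & farey T (val g *m map_mx intr c).
Proof.
have [[z [zE Yz]] lb] := F11P g; split.
  rewrite -zE => zT; apply: (farey_exists (det_SL2 g) (u := z)) => //.
  by rewrite zT andbT; exact: le_lt_trans Yz.
move=> [c dc /farey_vec[u [/andP[_ uT] Yu]]].
exact: le_trans (lb _ Yu) uT.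
Qed.

End farey.

(** * Measurability of conditions on the bases of a lattice *)

Section countable_basis.

Definition measurable_basis d (T : measurableType d) (nb : T -> set_system T)
    (I : Type) (U : I -> set T) : Prop :=
  (forall k, measurable (U k)) /\
  (forall x A, nb x A -> exists2 k, U k x & U k `<=` A).

Lemma measurable_basis_real (R : realType) :
  measurable_basis (nbhs : R -> set_system R)
    (fun q : rat * rat => `]ratr q.1, ratr q.2[%classic).
Proof.
split=> [q|x A /nbhs_ballP[e /= e0 xeA]]; first exact: measurable_itv.
have /rat_in_itvoo[q /itvP xq] : x - e < x by rewrite ltrBlDr ltrDl.
have /rat_in_itvoo[r /itvP xr] : x < x + e by rewrite ltrDl.
exists (q, r); first by rewrite /= in_itv /= xq xr.
move=> y /=; rewrite in_itv /= => /andP[qy yr]; apply: xeA; rewrite /ball /=.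
have h1 : x - e < ratr q by rewrite xq.
have h2 : ratr r < x + e by rewrite xr.
by rewrite ltr_distlC (lt_trans h1 qy) (lt_trans yr h2).
Qed.

Lemma measurable_basis_prod d1 d2 (T1 : measurableType d1) (T2 : measurableType d2)
    (nb1 : T1 -> set_system T1) (nb2 : T2 -> set_system T2)
    I1 I2 (U1 : I1 -> set T1) (U2 : I2 -> set T2) :
  measurable_basis nb1 U1 -> measurable_basis nb2 U2 ->
  measurable_basis (fun p : T1 * T2 => filter_prod (nb1 p.1) (nb2 p.2))
    (fun k : I1 * I2 => U1 k.1 `*` U2 k.2).
Proof.
move=> [mU1 bU1] [mU2 bU2]; split=> [k|[x y] A [[B C] /= [xB yC] BCA]].
  exact: measurableX.
have [k1 xk1 k1B] := bU1 _ _ xB; have [k2 yk2 k2C] := bU2 _ _ yC.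
by exists (k1, k2) => // -[z t] [/= /k1B zB /k2C tC]; exact: BCA.
Qed.

(** The countable base is on one factor only. For each base element U k, the union of all open V
    with U k x V inside W is open, however many V there are, and W is the countable union of the
    resulting rectangles. *)
Lemma open_prod_measurable d (T : measurableType d) (nb : T -> set_system T)
    (I : countType) (U : I -> set T) (X : ptopologicalType)
    (W : set (T * g_sigma_algebraType (@open X))) :
  measurable_basis nb U ->
  (forall p, W p -> exists A V, [/\ nb p.1 A, open V, V p.2 & A `*` V `<=` W]) ->
  measurable W.
Proof.
move=> [mU bU] oW.
pose V k : set X := \bigcup_(V in [set V | open V /\ U k `*` V `<=` W]) V.
have -> : W = \bigcup_k (U k `*` V k).
  apply/seteqP; split=> [[x y] Wxy|[x y] [k _ [/= xk [V' [oV' VW] yV']]]]; last exact: VW.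
  have [A [V' [/= xA oV' yV' AVW]]] := oW _ Wxy.
  have [k xk kA] := bU _ _ xA; exists k => //; split=> //=.
  by exists V' => //; split=> // -[z t] [/= /kA zA tV']; exact: AVW.
apply: countable_bigcupT_measurable => // k; apply: measurableX => //.
apply: sub_sigma_algebra; apply: bigcup_open => V' [] //.
Qed.

End countable_basis.

(** This compactness argument serves to exchange [exists c] and [forall n] in
    [measurable_exists_basis]. *)
Lemma finite_cap (T : choiceType) (P : nat -> set T) :
  (forall n m, (n <= m)%N -> P m `<=` P n) -> finite_set (P 0%N) ->
  (forall n, P n !=set0) -> exists x, forall n, P n x.
Proof.
move=> decP /finite_seqP[s sE] P0; apply: contrapT => noP.
have /choice[N PN] : forall x, exists n, ~ P n x.
  by move=> x; apply: contrapT => h; apply: noP; exists x => n; apply: contrapT => ?; apply: h; exists n.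
have [x Px] := P0 (\max_(x <- s) N x)%N.
have xs : x \in s by have := decP 0%N _ isT _ Px; rewrite sE.
by apply: (PN x); apply: decP Px; exact: leq_bigmax_seq.
Qed.

Section lattice_measurability.
Variable R : realType.
Local Open Scope quotient_scope.

Lemma entry_continuous (i j : 'I_2) : continuous (fun g : SL2 R => val g i j).
Proof.
move=> g; apply: (@continuous_comp _ _ _ (fun g : SL2 R => val g) (fun m : 'M[R]_2 => m i j)).
  exact: initial_continuous.
exact: coord_continuous.
Qed.

Lemma repr_piE (g : SL2 R) : exists c : 'M[int]_2,
  \det c = 1 /\ val (repr (\pi_(X2 R) g)) = val g *m map_mx intr c.
Proof.
have /pi_X2_eq[k [c dc cE] E] : \pi_(X2 R) g = \pi_(X2 R) (repr (\pi_(X2 R) g)).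
  by rewrite reprK.
by exists c; rewrite dc E /= -cE.
Qed.

Lemma exists_repr (P : 'M[R]_2 -> Prop) (g : SL2 R) :
  (exists2 c : 'M[int]_2, \det c = 1 & P (val (repr (\pi_(X2 R) g)) *m map_mx intr c)) <->
  (exists2 c : 'M[int]_2, \det c = 1 & P (val g *m map_mx intr c)).
Proof.
have [k [dk ->]] := repr_piE g; split=> -[c dc Pc].
  by exists (k *m c); rewrite ?det_mulmx ?dk ?dc ?mulr1// map_mxM mulmxA.
exists (\adj k *m c).
  have := congr1 determinant (mul_mx_adj k); rewrite dk !det_mulmx dk dc mul1r det1 => ->.
  by rewrite mul1r.
by rewrite map_mxM mulmxA -(mulmxA _ (map_mx _ k)) -map_mxM mul_mx_adj dk map_mx1 mulmx1.
Qed.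

Lemma open_exists_basis (P : 'I_2 -> 'I_2 -> set R) : (forall i j, open (P i j)) ->
  open [set L : X2 R | exists2 c : 'M[int]_2, \det c = 1 &
    forall i j, P i j ((val (repr L) *m map_mx intr c) i j)].
Proof.
move=> oP; rewrite /open/= /quotient_open.
pose A (c : 'M[int]_2) i j : set (SL2 R) :=
  (fun g : SL2 R => (val g *m map_mx intr c) i j) @^-1` P i j.
have oA c i j : open (A c i j).
  apply: open_comp => // g _ /=.
  rewrite (_ : (fun g => _) = fun g : SL2 R =>
     val g i 0 * (map_mx intr c 0 j) + val g i 1 * (map_mx intr c 1 j)); last first.
    by apply/funext => h; rewrite mulmx22.
  exact: (cvgD (cvgM (@entry_continuous i 0 g) (cvg_cst _))
              (cvgM (@entry_continuous i 1 g) (cvg_cst _))).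
rewrite (_ : _ @^-1` _ = \bigcup_(c in [set c : 'M[int]_2 | \det c = 1])
   ((A c 0 0 `&` A c 0 1) `&` (A c 1 0 `&` A c 1 1))); last first.
  apply/seteqP; split=> g /=.
    move/(exists_repr (fun m => forall i j, P i j (m i j))) => -[c dc Pc].
    by exists c => //; split; split; exact: Pc.
  move=> [c dc [[P00 P01] [P10 P11]]]; apply/(exists_repr (fun m => forall i j, P i j (m i j))).
  by exists c => // i j; case: (ord2P i) => ->; case: (ord2P j) => ->.
by apply: bigcup_open => c dc; apply: openI; exact: openI.
Qed.

End lattice_measurability.

Section farey_measurability.
Variable R : realType.
Implicit Types (m : 'M[R]_2) (c : 'M[int]_2) (A T e : R).
Local Open Scope quotient_scope.

(** The first vector (x, y) lies in a box since |y| < x < A. Nothing bounds y' directly, but the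
    determinant gives y' = (x' y + 1) / x, so the second vector lies in a box whose size [r u]
    depends on the first one. *)
Lemma finite_basis_in_strip A m : \det m = 1 ->
  finite_set [set c | \det c = 1 /\ let n := m *m map_mx intr c in
    [/\ 0 < n 0 0 < A, 0 < n 0 1 < A & `|n 1 0| < n 0 0]].
Proof.
rewrite det_mx22 => dm.
pose X (z : int * int) : R := m 0 0 * z.1%:~R + m 0 1 * z.2%:~R.
pose Y (z : int * int) : R := m 1 0 * z.1%:~R + m 1 1 * z.2%:~R.
pose box r := [set z | `|X z| <= r /\ `|Y z| <= r].
pose mk (uv : (int * int) * (int * int)) : 'M[int]_2 :=
  \matrix_(i, j) if i == 0 then if j == 0 then uv.1.1 else uv.2.1
                 else if j == 0 then uv.1.2 else uv.2.2.
pose r u := A + (A * A + 1) / X u.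
apply: (@sub_finite_set _ _ (mk @` (\bigcup_(u in box A) ([set u] `*` box (r u))))).
  move=> c [dc]; rewrite /= !mulmx22 !mxE => -[/andP[x0 xA] /andP[x'0 x'A]].
  pose u := (c 0 0, c 1 0); pose v := (c 0 1, c 1 1).
  rewrite -/(X u) -/(X v) -/(Y u) in x0 xA x'0 x'A *; move=> yx.
  have duv : X u * Y v - X v * Y u = 1.
    transitivity ((m 0 0 * m 1 1 - m 0 1 * m 1 0) * (\det c)%:~R); last by rewrite dm dc mul1r.
    by rewrite det_intmx22 intrB !intrM /X /Y /=; ring.
  exists (u, v); last first.
    by apply: matrix22P; rewrite !mxE.
  have YA : `|Y u| <= A by exact: ltW (lt_trans yx xA).
  have XA : `|X u| <= A by rewrite gtr0_norm// ltW.
  have X'A : `|X v| <= A by rewrite gtr0_norm// ltW.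
  exists u; first by split.
  split=> //; have A0 : 0 <= A by rewrite ltW// (lt_trans x0).
  have q0 : 0 <= (A * A + 1) / X u by apply: divr_ge0; [rewrite addr_ge0// mulr_ge0|exact: ltW].
  split; first by rewrite gtr0_norm// /r ler_wpDr// ltW.
  have YE : Y v = (X v * Y u + 1) / X u by rewrite -duv addrC subrK mulrAC divff ?mul1r ?gt_eqF.
  rewrite YE normrM normfV (gtr0_norm x0) /r ler_wpDl// ler_wpM2r//; first by rewrite invr_ge0 ltW.
  apply: (le_trans (ler_normD _ _)); rewrite normr1 lerD2r normrM.
  exact: ler_pM.
apply: finite_image; apply: bigcup_finite; first exact: finite_lattice_box.
by move=> u _; apply: finite_setX; [exact: finite_set1|exact: finite_lattice_box].
Qed.

(** [farey] mixes strict and large inequalities. Relaxing the large ones by e gives open conditions,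
    shrinking with e, whose conjunction over e = 1/(n+1) is [farey]. *)
Definition farey_slack e T m : Prop :=
  [/\ 0 < m 0 0 < T + e, 0 < m 0 1 < T + e, T < m 0 0 + m 0 1,
      `|m 1 0| < m 0 0 & m 0 1 - e < m 1 1].

Lemma farey_slackP T m : farey T m <-> forall n, farey_slack n.+1%:R^-1 T m.
Proof.
split=> [[/andP[x0 xT] /andP[x'0 x'T] xx yx y'] n|h].
  have : 0 < n.+1%:R^-1 :> R by rewrite invr_gt0.
  move: (n.+1%:R^-1 : R) => e e0.
  by split=> //; rewrite ?x0 ?x'0 /=; lra.
have [/andP[x0 _] /andP[x'0 _] xx yx _] := h 0%N.
have le (p q : R) : (forall n, p < q + n.+1%:R^-1) -> p <= q.
  move=> pq; apply/ler_addgt0Pr => e e0; apply: ltW.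
  have := pq (Num.truncn e^-1); move/lt_trans; apply; rewrite ltrD2l.
  by rewrite invf_plt ?posrE//; exact: truncnS_gt.
split=> //; rewrite ?x0 ?x'0 /=; apply: le => n; have [/andP[_ h1] /andP[_ h2] _ _ h3] := h n => //.
by rewrite -ltrBlDr.
Qed.

Lemma farey_slack_homo T m n k : (n <= k)%N ->
  farey_slack k.+1%:R^-1 T m -> farey_slack n.+1%:R^-1 T m.
Proof.
move=> nk [/andP[x0 xT] /andP[x'0 x'T] xx yx y'].
have : k.+1%:R^-1 <= n.+1%:R^-1 :> R by rewrite lef_pV2 ?posrE// ler_nat.
move: (k.+1%:R^-1 : R) (n.+1%:R^-1 : R) xT x'T y' => e e' xT x'T y' ee'.
by split=> //; rewrite ?x0 ?x'0 /=; lra.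
Qed.

Lemma continuous_gt0_near (S : topologicalType) (f : S -> R) s :
  {for s, continuous f} -> 0 < f s -> \forall t \near s, 0 < f t.
Proof. by move=> cf fs; exact: (cvgr_gt _ cf). Qed.

Lemma farey_slack_near e T (S : topologicalType) (f : S -> 'M[R]_2) s :
  (forall i j, {for s, continuous (fun t => f t i j)}) ->
  farey_slack e T (f s) -> \forall t \near s, farey_slack e T (f t).
Proof.
move=> cf [/andP[x0 xT] /andP[x'0 x'T] xx yx y'].
have cc (r : R) : {for s, continuous (fun=> r)} by exact: cst_continuous.
have near_lt (g h : S -> R) : {for s, continuous g} -> {for s, continuous h} ->
    g s < h s -> \forall t \near s, g t < h t.
  move=> cg ch gh; have : 0 < (h - g) s by rewrite subr_gt0.
  move/continuous_gt0_near => /(_ (continuousB ch cg)).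
  by apply: filterS => t; rewrite subr_gt0.
have cn : {for s, continuous (fun t => `|f t 1 0|)}.
  by apply: continuous_comp; [exact: cf|exact: norm_continuous].
have h1 := near_lt _ _ (cc 0) (cf 0 0) x0.
have h2 := near_lt _ _ (cf 0 0) (cc (T + e)) xT.
have h3 := near_lt _ _ (cc 0) (cf 0 1) x'0.
have h4 := near_lt _ _ (cf 0 1) (cc (T + e)) x'T.
have h5 := near_lt _ _ (cc T) (continuousD (cf 0 0) (cf 0 1)) xx.
have h6 := near_lt _ _ cn (cf 0 0) yx.
have h7 := near_lt _ _ (continuousB (cf 0 1) (cc e)) (cf 1 1) y'.
near=> t; split; [apply/andP; split|apply/andP; split|..]; by near: t.
Unshelve. all: by end_near. Qed.

(** The triple of reals carries a parameter of the group. For fixed n the set is open, as a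
    condition on some basis. The single c good for all n exists because only finitely many bases
    satisfy [Q 0], all of them being in the strip of width T + 1. *)
Lemma measurable_exists_basis (Q : nat -> set ((R * R * R) * 'M[R]_2)) T :
  (forall n, open (Q n)) -> (forall n k, (n <= k)%N -> Q k `<=` Q n) ->
  (forall p, Q 0%N p -> farey_slack 1 T p.2) ->
  measurable [set p : (R * R * R) * borelX2 R | exists2 c, \det c = 1 &
    forall n, Q n (p.1, val (repr p.2) *m map_mx intr c)].
Proof.
move=> oQ dQ QT.
pose E n := [set p : (R * R * R) * borelX2 R | exists2 c, \det c = 1 &
    Q n (p.1, val (repr p.2) *m map_mx intr c)].
rewrite (_ : [set p | _] = \bigcap_n E n); last first.
  apply/seteqP; split=> [p [c dc Qc] n _|p Ep]; first by exists c => //; exact: Qc.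
  pose P n := [set c | \det c = 1 /\ Q n (p.1, val (repr p.2) *m map_mx intr c)].
  have [||n|c Pc] := @finite_cap _ P.
  - by move=> n k nk c [dc Qc]; split=> //; exact: dQ Qc.
  - apply: (sub_finite_set _ (finite_basis_in_strip (T + 1) (det_SL2 (repr p.2)))).
    by move=> c [dc /QT[/= ? ? _ ? _]]; split.
  - by have [c dc Qc] := Ep n I; exists c.
  - by exists c => [|n]; [exact: (Pc 0%N).1|exact: (Pc n).2].
apply: bigcapT_measurable => n.
apply: (@open_prod_measurable _ _ _ _ _ (X2 R) (E n) (measurable_basis_prod (measurable_basis_prod
  (@measurable_basis_real R) (@measurable_basis_real R)) (@measurable_basis_real R))).
move=> -[t L] [c dc Qc].
have [[A B] /= [At [P mP PB]] ABQ] : nbhs (t, val (repr L) *m map_mx intr c) (Q n).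
  by apply: open_nbhs_nbhs; split.
exists A, [set L : X2 R | exists2 c, \det c = 1 &
  forall i j, (P i j)° ((val (repr L) *m map_mx intr c) i j)]; split => //.
- apply: (open_exists_basis (P := fun i j => (P i j)°)) => i j; exact: open_interior.
- by exists c => // i j; exact: (mP i j).
- move=> [t' L'] [/= At' [c' dc' Pc']]; exists c' => //; apply: ABQ; split => //=.
  apply: (PB (val (repr L') *m map_mx intr c')) => i j.
  exact: (interior_subset (Pc' i j)).
Qed.

End farey_measurability.

(** * The gap density, its integral and their behaviour under SL(2,R) *)

Section affine_substitution.
Local Open Scope ereal_scope.
Variable R : realType.
Local Notation leb := (@lebesgue_measure R).

Lemma ge0_integral_affine (k l : R) (f : R -> \bar R) : (k != 0)%R ->
  measurable_fun [set: R] f -> (forall x, 0 <= f x) ->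
  `|k|%:E * \int[leb]_x f (k * x + l)%R = \int[leb]_x f x.
Proof.
move=> k0 mf f0.
pose phi : R -> measurableTypeR R := fun x => (k * x + l)%R.
have mphi : measurable_fun [set: R] phi.
  by apply: measurable_funD => //; exact: measurable_funM.
pose nu' := mscale (NngNum (normr_ge0 k)) (pushforward leb phi).
pose nu := nu' mphi.
have nuE A : measurable A -> leb A = nu A.
  apply: lebesgue_measure_unique => _ [[a b]] /= _ <-.
  rewrite /nu /nu' /mscale /= /pushforward.
  have [k_gt0|k_lt0] := orP (lt_total k0)%R; last first.
    rewrite (_ : _ @^-1` _ = `](a - l) / k, (b - l) / k]%classic)%R; last first.
      apply/seteqP; split=> x; rewrite /phi /= !in_itv /=;
        by rewrite ltr_pdivrMr// ler_pdivlMr// ltrBlDr lerBrDr (mulrC x).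
    rewrite !lebesgue_measure_itv /= !lte_fin ltr_pM2r ?invr_gt0// ltrD2r.
    case: ifPn => // _; last by rewrite mule0.
    by rewrite -!EFinB -EFinM gtr0_norm//; congr (_%:E); field.
  rewrite (_ : _ @^-1` _ = `[(b - l) / k, (a - l) / k[%classic)%R; last first.
    apply/seteqP; split=> x; rewrite /phi /= !in_itv /=;
      by rewrite ltr_ndivlMr// ler_ndivrMr// ltrBlDr lerBrDr (mulrC x) andbC.
  rewrite !lebesgue_measure_itv /= !lte_fin ltr_nM2r ?invr_lt0// ltrD2r.
  case: ifPn => // _; last by rewrite mule0.
  by rewrite -!EFinB -EFinM ltr0_norm//; congr (_%:E); field.
transitivity (\int[nu]_x f x); last first.
  by apply: eq_measure_integral => A mA _; apply/esym; exact: nuE.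
rewrite /nu /nu' ge0_integral_mscale//=; congr (_ * _).
rewrite ge0_integral_pushforward//.
Qed.

End affine_substitution.

Section gap_density.
Variable R : realType.
Implicit Types T x : R.
Local Notation leb := (@lebesgue_measure R).

Definition farey_triangle T x x' : bool :=
  [&& 0 < x, x <= T, 0 < x', x' <= T & T < x + x'].

(* The slopes of two vectors of first coordinates x, x' and of determinant 1 differ
   by 1/(x x'), and the slopes of the vectors of C1 fill an interval of length 2. *)
Definition gap_density T x x' : R :=
  if farey_triangle T x x' then (Num.max 2^-1 (x * x'))^-1 else 0.

Definition gap_integral T : \bar R :=
  (\int[leb]_x \int[leb]_x' (gap_density T x x')%:E)%E.

Lemma gap_density_ge0 T x x' : 0 <= gap_density T x x'.
Proof.
by rewrite /gap_density; case: ifP => // _; rewrite invr_ge0 le_max invr_ge0 ler0n.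
Qed.

Lemma gap_density_le2 T x x' : gap_density T x x' <= 2.
Proof.
rewrite /gap_density; case: ifP => // _.
rewrite -[leRHS]invrK lef_pV2 ?posrE ?lt_max ?invr_gt0 ?ltr0n//.
by rewrite le_max lexx.
Qed.

Lemma measurable_gap_density T d (S : measurableType d) (f g : S -> R) :
  measurable_fun setT f -> measurable_fun setT g ->
  measurable_fun setT (fun s => gap_density T (f s) (g s)).
Proof.
move=> mf mg; apply: measurable_fun_ifT => //.
  apply: measurable_and; first exact: measurable_fun_ltr.
  apply: measurable_and; first exact: measurable_fun_ler.
  apply: measurable_and; first exact: measurable_fun_ltr.
  apply: measurable_and; first exact: measurable_fun_ler.
  by apply: measurable_fun_ltr => //; exact: measurable_funD.
apply: (@measurableT_comp _ _ _ _ _ _ (fun u : R => (Num.max 2^-1 u)^-1) _ (fun s => f s * g s)).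
  apply: continuous_measurable_fun => u; apply: cvgV.
    by rewrite gt_eqF// lt_max invr_gt0 ltr0n.
  by apply: (@continuous_max _ _ (fun=> 2^-1) id); [exact: cst_continuous|exact: cvg_id].
exact: measurable_funM.
Qed.

(** The two slopes are s and s + g with g = 1/(x x'), and the shear adds a to both. The conditions
    -1 < s + a < 1 <= s + g + a define an interval ending at 1 - s, of length min(2, g). *)
Lemma lebesgue_shear_farey T x x' y y' : x * y' - x' * y = 1 ->
  leb [set a | [/\ 0 < x <= T, 0 < x' <= T, T < x + x',
      `|y + a * x| < x & x' <= y' + a * x']] = (gap_density T x x')%:E.
Proof.
move=> d1; rewrite /gap_density; case: ifPn => [/and5P[x0 xT x'0 x'T xx]|nT]; last first.
  rewrite [X in leb X](_ : _ = set0) ?measure0//.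
  apply/seteqP; split => // a [/andP[h1 h2] /andP[h3 h4] h5 _ _].
  by move: nT; rewrite /farey_triangle h1 h2 h3 h4 h5.
have xx0 : 0 < x * x' by exact: mulr_gt0.
set s := y / x; have yE : y = s * x by rewrite divfK ?gt_eqF.
set g := (x * x')^-1; have g0 : 0 < g by rewrite invr_gt0.
have y'E : y' = (s + g) * x'.
  rewrite /s /g; apply: (mulfI (lt0r_neq0 x0)); rewrite -[LHS](subrK (x' * y)) d1.
  by field; rewrite !gt_eqF.
have setE a : (`|y + a * x| < x /\ x' <= y' + a * x') <->
    [/\ - 1 - s < a, a < 1 - s & 1 - s - g <= a].
  rewrite yE y'E -!mulrDl normrM (gtr0_norm x0) -[X in _ < X]mul1r ltr_pM2r//.
  rewrite -[X in X <= _]mul1r ler_pM2r// ltr_norml; split.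
    by move=> [/andP[h1 h2] h3]; split; lra.
  by move=> [h1 h2 h3]; split; [apply/andP; split|]; lra.
have [gle|gge] := leP (x * x') 2^-1.
  rewrite invrK.
  have g2 : 2 <= g by rewrite -[leLHS]invrK lef_pV2// posrE.
  rewrite [X in leb X](_ : _ = `]- 1 - s, 1 - s[%classic).
    rewrite lebesgue_measure_itv /= lte_fin ltrD2r ifT; last by lra.
    by rewrite -EFinB; congr (_%:E); ring.
  apply/seteqP; split => a /=; rewrite in_itv /=.
    by move=> [_ _ _ h1 h2]; have /setE[-> -> _] := conj h1 h2.
  move=> /andP[h1 h2]; have [] := (setE a).2; first by split=> //; lra.
  by move=> h3 h4; split=> //; apply/andP.
rewrite -/g.
have g2 : g < 2 by rewrite -[ltRHS]invrK ltf_pV2// posrE invr_gt0.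
rewrite [X in leb X](_ : _ = `[1 - s - g, 1 - s[%classic).
  rewrite lebesgue_measure_itv /= lte_fin ifT; last by lra.
  by rewrite -EFinB; congr (_%:E); ring.
apply/seteqP; split => a /=; rewrite in_itv /=.
  by move=> [_ _ _ h1 h2]; have /setE[_ -> ->] := conj h1 h2.
move=> /andP[h1 h2]; have [] := (setE a).2; first by split=> //; lra.
by move=> h3 h4; split=> //; apply/andP.
Qed.

Local Open Scope ereal_scope.

(** The measure |b| db dc is Lebesgue measure in the row (1 + b c, b), and multiplication of rows by
    a matrix of determinant 1 preserves it. Concretely, x replaces c, with Jacobian |b| p; after an
    exchange of the integrals, x' = b / p + r x / p replaces b, with Jacobian 1 / p. *)
Lemma gap_integral_right_invariant T (p q r w : R) : (0 < p)%R ->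
  (p * w - r * q = 1)%R ->
  \int[leb]_b (`|b|%:E * \int[leb]_c
    (gap_density T ((1 + b * c) * p + b * q) ((1 + b * c) * r + b * w))%:E)
  = gap_integral T.
Proof.
move=> p0 d1.
pose f b x := (gap_density T x (p^-1 * b + r * x / p))%:E.
have mf : measurable_fun setT (fun z : R * R => f z.1 z.2).
  apply/measurable_EFinP; apply: measurable_gap_density => //.
  by apply: measurable_funD; apply: measurable_funM => //; apply: measurable_funM.
have f0 b x : 0 <= f b x by rewrite lee_fin gap_density_ge0.
have mF : measurable_fun [set: R] (fun b => \int[leb]_x f b x).
  exact: (@measurable_fun_fubini_tonelli_F _ _ _ _ _ leb (fun z => f z.1 z.2) mf (fun=> f0 _ _)).
have mG : measurable_fun [set: R] (fun x => \int[leb]_b f b x).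
  exact: (@measurable_fun_fubini_tonelli_G _ _ _ _ _ leb (fun z => f z.1 z.2) mf (fun=> f0 _ _)).
pose h (z : R * R) := (gap_density T ((1 + z.1 * z.2) * p + z.1 * q) ((1 + z.1 * z.2) * r + z.1 * w))%:E.
have mh : measurable_fun setT h.
  apply/measurable_EFinP; apply: measurable_gap_density;
    by do ![apply: measurable_funD|apply: measurable_funM|apply: measurable_fst
            |apply: measurable_snd|apply: measurable_cst].
have h0 z : 0 <= h z by rewrite lee_fin gap_density_ge0.
have mH : measurable_fun [set: R] (fun b => \int[leb]_c h (b, c)).
  exact: (@measurable_fun_fubini_tonelli_F _ _ _ _ _ leb h mh h0).
transitivity (\int[leb]_b ((p^-1)%:E * \int[leb]_x f b x)).
  apply: ae_eq_integral => //.
  - apply: emeasurable_funM => //; apply/measurable_EFinP.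
    exact: normr_measurable.
  - exact: measurable_funeM.
  (* At b = 0 the first coordinate no longer depends on c and the substitution fails; this is a null
     set. *)
  exists [set 0%R]; split=> //; first exact: lebesgue_measure_set1.
  move=> b /=; apply: contra_notP => b0 _.
  have {}b0 : b != 0%R by apply/eqP.
  rewrite -(@ge0_integral_affine _ (b * p) (p + b * q) (f b)); first last.
  - by [].
  - by apply/measurable_EFinP; apply: measurable_gap_density => //;
      apply: measurable_funD => //; apply: measurable_funM => //; apply: measurable_funM.
  - by rewrite mulf_neq0// gt_eqF.
  rewrite muleA -EFinM normrM (gtr0_norm p0) mulrCA mulVf ?gt_eqF// mulr1.
  congr (_ * _); apply: eq_integral => c _; congr ((gap_density _ _ _)%:E).
    by ring.
  rewrite (_ : w = (1 + r * q) / p)%R; last by rewrite -d1 subrK mulrC mulKf// gt_eqF.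
  by field; rewrite gt_eqF.
rewrite ge0_integralZl//; last 2 first.
- by move=> b _; exact: integral_ge0.
- by rewrite lee_fin invr_ge0 ltW.
rewrite (@fubini_tonelli _ _ _ _ _ leb leb (fun z => f z.1 z.2))//=.
rewrite /gap_integral -ge0_integralZl//; last 2 first.
- by move=> b _; exact: integral_ge0.
- by rewrite lee_fin invr_ge0 ltW.
apply: eq_integral => x _.
rewrite -(@ge0_integral_affine _ p^-1 (r * x / p) (fun x' => (gap_density T x x')%:E))//.
- by rewrite gtr0_norm ?invr_gt0.
- by rewrite invr_neq0// gt_eqF.
- by apply/measurable_EFinP; apply: measurable_gap_density.
- by move=> x'; rewrite lee_fin gap_density_ge0.
Qed.

End gap_density.

(** * The Haar average of the overlap, and the law of [F11] up to a factor *)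

Section haar.
Variable R : realType.
Implicit Types (T : R) (t : R * R * R) (m : 'M[R]_2).
Local Notation leb := (@lebesgue_measure R).
Local Open Scope quotient_scope.

(* For t = ((b, c), a) this is the product [1 0; a 1] [1 b; 0 1] [1 0; c 1];
   in these coordinates |b| da db dc is a Haar measure of SL(2,R). *)
Definition lul t : 'M[R]_2 := \matrix_(i, j)
  if i == 0 then if j == 0 then 1 + t.1.1 * t.1.2 else t.1.1
  else if j == 0 then t.2 * (1 + t.1.1 * t.1.2) + t.1.2 else t.2 * t.1.1 + 1.

(** Inverting the product reverses its three factors and negates their parameters. The shape
    lower-upper-lower is thus preserved: a and c are exchanged, b stays in the middle, and the
    density |b| is unchanged, so that invariance under inversion reduces to Fubini and
    reflections. *)
Definition lul_inv t : R * R * R := (- t.1.1, - t.2, - t.1.2).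

Lemma det_lul t : \det (lul t) = 1.
Proof. by rewrite det_mx22 !mxE /=; ring. Qed.

Lemma lul_invK t : lul (lul_inv t) *m lul t = 1%:M.
Proof. by apply: matrix22P; rewrite mulmx22 !mxE /=; ring. Qed.

Definition lul_SL2 t : SL2 R := mkSL2 (det_lul t).

Definition farey_overlap T T' : set (R * R * R * borelX2 R) :=
  [set p | exists2 c : 'M[int]_2, \det c = 1 &
    farey T (val (repr p.2) *m map_mx intr c) /\
    farey T' (lul p.1 *m (val (repr p.2) *m map_mx intr c))].

Lemma continuous_lul t i j : {for t, continuous (fun t => lul t i j)}.
Proof.
have cc (r : R) : {for t, continuous (fun=> r)} by exact: cst_continuous.
have cb : {for t, continuous (fun t : R * R * R => t.1.1)}.
  exact: (cvg_comp fst fst cvg_fst cvg_fst).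
have ca : {for t, continuous (fun t : R * R * R => t.1.2)}.
  exact: (cvg_comp fst snd cvg_fst cvg_snd).
have c2 : {for t, continuous (fun t : R * R * R => t.2)} by exact: cvg_snd.
have E (i' j' : 'I_2) g : {for t, continuous g} -> (forall u, lul u i' j' = g u) ->
    {for t, continuous (fun u => lul u i' j')}.
  by move=> cg gE; rewrite (_ : (fun u => _) = g)//; apply/funext.
case: (ord2P i) => ->; case: (ord2P j) => ->.
- apply: (E _ _ (fun u => 1 + u.1.1 * u.1.2)); last by move=> u; rewrite mxE.
  exact: (continuousD (cc 1) (continuousM cb ca)).
- by apply: (E _ _ (fun u => u.1.1)) => // u; rewrite mxE.
- apply: (E _ _ (fun u => u.2 * (1 + u.1.1 * u.1.2) + u.1.2)); last by move=> u; rewrite mxE.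
  exact: (continuousD (continuousM c2 (continuousD (cc 1) (continuousM cb ca))) ca).
- apply: (E _ _ (fun u => u.2 * u.1.1 + 1)); last by move=> u; rewrite mxE.
  exact: (continuousD (continuousM c2 cb) (cc 1)).
Qed.

Lemma measurable_farey_overlap T T' : measurable (farey_overlap T T').
Proof.
pose Q (n : nat) : set (R * R * R * 'M[R]_2) := [set p |
  farey_slack n.+1%:R^-1 T p.2 /\ farey_slack n.+1%:R^-1 T' (lul p.1 *m p.2)].
rewrite (_ : farey_overlap T T' = [set p : (R * R * R) * borelX2 R |
    exists2 c : 'M[int]_2, \det c = 1 &
    forall n, Q n (p.1, val (repr p.2) *m map_mx intr c)]).
  apply: (@measurable_exists_basis _ Q T).
  - move=> n; rewrite openE => p [p1 p2]; apply: filterI.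
      apply: (@farey_slack_near _ _ T _ (fun p : R * R * R * 'M[R]_2 => p.2) p) p1.
      by move=> i j; exact: (cvg_comp snd (fun m : 'M[R]_2 => m i j) cvg_snd (@coord_continuous _ _ _ i j _)).
    apply: (@farey_slack_near _ _ T' _ (fun p : R * R * R * 'M[R]_2 => lul p.1 *m p.2) p) p2.
    move=> i j.
    have cl k : {for p, continuous (fun p : R * R * R * 'M[R]_2 => lul p.1 i k)}.
      exact: (cvg_comp fst (fun t => lul t i k) cvg_fst (@continuous_lul _ i k)).
    have cm k : {for p, continuous (fun p : R * R * R * 'M[R]_2 => p.2 k j)}.
      exact: (cvg_comp snd (fun m : 'M[R]_2 => m k j) cvg_snd (@coord_continuous _ _ _ k j _)).
    rewrite (_ : (fun p => _) = fun p : R * R * R * 'M[R]_2 =>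
      lul p.1 i 0 * p.2 0 j + lul p.1 i 1 * p.2 1 j); last first.
      by apply/funext => u; rewrite mulmx22.
    exact: (continuousD (continuousM (cl 0) (cm 0)) (continuousM (cl 1) (cm 1))).
  - by move=> n k nk p [p1 p2]; split; exact: farey_slack_homo nk _.
  - by move=> p [+ _]; rewrite invr1.
apply/seteqP; split=> p [c dc].
  by move=> [/farey_slackP p1 /farey_slackP p2]; exists c => // n; split.
by move=> Qc; exists c => //; split; apply/farey_slackP => n; have [] := Qc n.
Qed.

End haar.

Section haar_average.
Variable R : realType.
Implicit Types (T : R) (t : R * R * R) (m : 'M[R]_2).
Local Notation leb := (@lebesgue_measure R).
Local Open Scope quotient_scope.
Local Open Scope ereal_scope.

Lemma ge0_integral_lebN (f : R -> \bar R) :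
  measurable_fun [set: R] f -> (forall x, 0 <= f x) ->
  \int[leb]_x f (- x)%R = \int[leb]_x f x.
Proof.
move=> mf f0; rewrite -(@ge0_integral_affine _ (-1) 0 f)// ?oppr_eq0 ?oner_eq0//.
by rewrite normrN1 mul1e; apply: eq_integral => x _; rewrite mulN1r addr0.
Qed.

Local Notation fubini_F_measurable := (@measurable_fun_fubini_tonelli_F _ _ _ _ _ leb).

Lemma integral_lul_inv (f : R * R * R -> \bar R) :
  measurable_fun setT f -> (forall t, 0 <= f t) ->
  \int[leb]_b \int[leb]_c \int[leb]_a f (lul_inv (b, c, a)) =
  \int[leb]_b \int[leb]_c \int[leb]_a f (b, c, a).
Proof.
move=> mf f0.
pose F (z : R * R) := \int[leb]_a f (z, a).
have mF : measurable_fun [set: R * R] F by exact: fubini_F_measurable.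
have F0 z : 0 <= F z by exact: integral_ge0.
pose G b := \int[leb]_c F (b, c).
have mG : measurable_fun [set: R] G by exact: fubini_F_measurable.
have G0 b : 0 <= G b by exact: integral_ge0.
have mNf b : measurable_fun [set: R * R] (fun z : R * R => f (- b, - z.2, - z.1)%R).
  apply: measurableT_comp => //; apply: measurable_fun_pair.
    apply: measurable_fun_pair => //.
    by apply: measurableT_comp => //; exact: measurable_snd.
  by apply: measurableT_comp => //; exact: measurable_fst.
have mFb b : measurable_fun [set: R] (fun c => F (b, c)).
  exact: measurableT_comp mF (pair1_measurable _).
have mfb z : measurable_fun [set: R] (fun a => f (z, a)).
  exact: measurableT_comp mf (pair1_measurable _).
transitivity (\int[leb]_b G (- b)%R); last exact: ge0_integral_lebN.
apply: eq_integral => b _.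
transitivity (\int[leb]_a \int[leb]_c f (- b, - a, - c)%R).
  exact: (@fubini_tonelli _ _ _ _ _ leb leb (fun z => f (- b, - z.2, - z.1)%R) (mNf b) (fun=> f0 _)).
transitivity (\int[leb]_c F (- b, - c)%R).
  by apply: eq_integral => a _; exact: ge0_integral_lebN.
exact: ge0_integral_lebN.
Qed.

Lemma fubini_tonelli_leb3 d (X : measurableType d)
    (mu : {sigma_finite_measure set X -> \bar R}) (f : X * R * R * R -> \bar R) :
  measurable_fun setT f -> (forall p, 0 <= f p) ->
  \int[mu]_x \int[leb]_b \int[leb]_c \int[leb]_a f (x, b, c, a) =
  \int[leb]_b \int[leb]_c \int[leb]_a \int[mu]_x f (x, b, c, a).
Proof.
move=> mf f0.
pose F (z : X * R * R) := \int[leb]_a f (z, a).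
have mF : measurable_fun [set: X * R * R] F by exact: fubini_F_measurable.
have F0 z : 0 <= F z by exact: integral_ge0.
pose G (z : X * R) := \int[leb]_c F (z, c).
have mG : measurable_fun [set: X * R] G by exact: fubini_F_measurable.
have G0 z : 0 <= G z by exact: integral_ge0.
transitivity (\int[leb]_b \int[mu]_x G (x, b)).
  exact: (@fubini_tonelli _ _ _ _ _ mu leb G mG G0).
apply: eq_integral => b _.
have mb : measurable_fun [set: X * R] (fun z : X * R => (z.1, b, z.2)).
  apply: measurable_fun_pair; last exact: measurable_snd.
  by apply: measurable_fun_pair => //; exact: measurable_fst.
transitivity (\int[leb]_c \int[mu]_x F (x, b, c)).
  apply: (@fubini_tonelli _ _ _ _ _ mu leb (fun z => F (z.1, b, z.2))) => //.
  exact: measurableT_comp mF mb.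
apply: eq_integral => c _.
have mc : measurable_fun [set: X * R] (fun z : X * R => (z.1, b, c, z.2)).
  apply: measurable_fun_pair; last exact: measurable_snd.
  apply: measurable_fun_pair => //.
  by apply: measurable_fun_pair => //; exact: measurable_fst.
apply: (@fubini_tonelli _ _ _ _ _ mu leb (fun z => f (z.1, b, c, z.2))) => //.
exact: measurableT_comp mf mc.
Qed.

End haar_average.

Section F11_law.
Variable R : realType.
Implicit Types (T : R) (t : R * R * R) (L : borelX2 R).
Local Notation leb := (@lebesgue_measure R).
Local Open Scope quotient_scope.

Lemma F11_repr_le T (L : X2 R) : F11 L <= T <->
  exists2 c : 'M[int]_2, \det c = 1 & farey T (val (repr L) *m map_mx intr c).
Proof. by rewrite -[in F11 L](reprK L); exact: F11_le. Qed.

Lemma measurable_F11_le T : measurable [set L : borelX2 R | F11 L <= T].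
Proof.
pose Q (n : nat) : set (R * R * R * 'M[R]_2) := [set p | farey_slack n.+1%:R^-1 T p.2].
have mE : measurable [set p : (R * R * R) * borelX2 R |
    exists2 c : 'M[int]_2, \det c = 1 &
    forall n, Q n (p.1, val (repr p.2) *m map_mx intr c)].
  apply: (@measurable_exists_basis _ Q T).
  - move=> n; rewrite openE => p p2.
    apply: (@farey_slack_near _ _ T _ (fun p : R * R * R * 'M[R]_2 => p.2) p) p2.
    by move=> i j; exact: (cvg_comp snd (fun m : 'M[R]_2 => m i j) cvg_snd (@coord_continuous _ _ _ i j _)).
  - by move=> n k nk p; exact: farey_slack_homo nk.
  - by move=> p; rewrite /Q/= invr1.
have := measurable_xsection (point : R * R * R) mE; congr measurable.
apply/seteqP; split=> L; rewrite xsectionE /=.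
  by move=> [c dc Qc]; apply/F11_repr_le; exists c => //; exact/farey_slackP.
by move=> /F11_repr_le[c dc /farey_slackP Qc]; exists c.
Qed.

Lemma mem_farey_overlap T T' t L (c : 'M[int]_2) : \det c = 1 ->
  farey T (val (repr L) *m map_mx intr c) ->
  farey_overlap T T' (t, L) <-> farey T' (lul t *m (val (repr L) *m map_mx intr c)).
Proof.
move=> dc Tc; split=> [[k dk [Tk T'k]]|T'c]; last by exists c.
by rewrite (farey_basis_uniq dc dk Tc Tk).
Qed.

Lemma farey_lul T b c a (m : 'M[R]_2)
    (x := (1 + b * c) * m 0 0 + b * m 1 0) (x' := (1 + b * c) * m 0 1 + b * m 1 1) :
  farey T (lul (b, c, a) *m m) = [/\ 0 < x <= T, 0 < x' <= T, T < x + x',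
    `|(c * m 0 0 + m 1 0) + a * x| < x & x' <= (c * m 0 1 + m 1 1) + a * x'].
Proof.
rewrite /farey !mulmx22 !mxE /= -/x -/x'.
have -> : (a * (1 + b * c) + c) * m 0 0 + (a * b + 1) * m 1 0 =
  (c * m 0 0 + m 1 0) + a * x by rewrite /x; ring.
by have -> : (a * (1 + b * c) + c) * m 0 1 + (a * b + 1) * m 1 1 =
  (c * m 0 1 + m 1 1) + a * x' by rewrite /x'; ring.
Qed.

Local Open Scope ereal_scope.

(** If [F11 L] <= T, uniqueness lets the basis be fixed as h, whatever the group element.
    Integrating in a is a shear, giving the gap density of the first row of the product with h;
    right invariance then removes h. Otherwise L has no Farey basis for T. *)
Lemma integral_farey_overlap T T' L :
  \int[leb]_b \int[leb]_c \int[leb]_a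
     (`|b|%:E * (\1_(farey_overlap T T') (b, c, a, L))%:E) =
  (\1_[set L : borelX2 R | (F11 L <= T)%R] L)%:E * gap_integral T'.
Proof.
rewrite [in RHS]indicE; have [|] := boolP (L \in _); last first.
  move=> /negP LT; rewrite mul0e.
  have E0 t : \1_(farey_overlap T T') (t, L) = 0%R :> R.
    rewrite indicE memNset// => -[c dc [Tc _]]; apply: LT.
    by apply/mem_set/F11_repr_le; exists c.
  apply: integral0_eq => b _; apply: integral0_eq => c _.
  by apply: integral0_eq => a _; rewrite E0 mule0.
move=> /set_mem/F11_repr_le[c0 dc0 Tc]; rewrite mul1e.
pose h := val (repr L) *m map_mx intr c0.
have dh : \det h = 1%R by rewrite det_mulmx det_SL2 det_map_mx dc0 mulr1.
have h0 : (0 < h 0 0)%R by case: Tc => /andP[].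
rewrite -(@gap_integral_right_invariant _ T' (h 0%R 0%R) (h 1%R 0%R) (h 0%R 1%R) (h 1%R 1%R))//; last first.
  by rewrite -det_mx22.
apply: eq_integral => b _.
have mE b' c : measurable [set a | farey_overlap T T' (b', c, a, L)].
  have := measurable_xsection (b', c) (measurable_ysection L (measurable_farey_overlap T T')).
  by congr measurable; apply/seteqP; split=> a; rewrite xsectionE ysectionE.
have inner c : \int[leb]_a (`|b|%:E * (\1_(farey_overlap T T') (b, c, a, L))%:E) =
    `|b|%:E * (gap_density T' ((1 + b * c) * h 0 0 + b * h 1 0) ((1 + b * c) * h 0 1 + b * h 1 1))%:E.
  rewrite ge0_integralZl_EFin//; last first.
    by apply/measurable_EFinP; exact: (measurable_indic (mE b c)).
  congr (_ * _); transitivity (leb ([set a | farey_overlap T T' (b, c, a, L)] `&` setT)).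
    exact: (integral_indic leb measurableT (mE b c)).
  rewrite [X in leb X = _](_ : _ = [set a | farey_overlap T T' (b, c, a, L)]); last exact: setIT.
  rewrite -(@lebesgue_shear_farey _ _ _ _ (c * h 0 0 + h 1 0)%R (c * h 0 1 + h 1 1)%R).
    congr (leb _); apply/funext => a; apply/propext => /=.
    by rewrite -farey_lul; exact: mem_farey_overlap.
  rewrite -[RHS]dh det_mx22; ring.
under eq_integral do rewrite inner.
rewrite ge0_integralZl_EFin//; last 2 first.
- by move=> c _; rewrite lee_fin gap_density_ge0.
- apply/measurable_EFinP; apply: measurable_gap_density;
    by do ![apply: measurable_funD|apply: measurable_funM].
Qed.


Variable mu2 : probability (borelX2 R) R.
Hypothesis mu2_inv : SL2_invariant mu2.

(** With g = [lul t], a basis m of L is Farey for T with g m Farey for T' exactly when the basis n =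
    g m of g L is Farey for T' and the inverse of g sends it to one Farey for T. The invariance of
    [mu2] is used here alone. *)
Lemma xsection_overlap_lul_inv T T' t :
  mu2 (xsection (farey_overlap T T') t) =
  mu2 (xsection (farey_overlap T' T) (lul_inv t)).
Proof.
rewrite -[RHS](mu2_inv (lul_SL2 t)); last exact: measurable_xsection (measurable_farey_overlap _ _).
congr (mu2 _); apply/seteqP.
have E L : xsection (farey_overlap T T') t L <->
    xsection (farey_overlap T' T) (lul_inv t) (actX2 (lul_SL2 t) L).
  rewrite !xsectionE /= /actX2.
  have K := exists_repr (fun m => farey T' m /\ farey T (lul (lul_inv t) *m m)) (SL2_mul (lul_SL2 t) (repr L)).
  split=> [[c dc [h1 h2]]|/K[c dc /= [h1 h2]]].
    by apply/K; exists c => //=; rewrite -mulmxA; split=> //; rewrite mulmxA lul_invK mul1mx.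
  exists c => //; rewrite mulmxA; split=> //.
  by move: h2; rewrite !mulmxA lul_invK mul1mx.
by split=> L; [exact: (E L).1|exact: (E L).2].
Qed.

Let leb_mu2_overlap T T' := \int[leb]_b \int[leb]_c \int[leb]_a
  (`|b|%:E * mu2 (xsection (farey_overlap T T') (b, c, a))).

Let leb_mu2_overlapE T T' :
  leb_mu2_overlap T T' = mu2 [set L | (F11 L <= T)%R] * gap_integral T'.
Proof.
pose f (p : borelX2 R * R * R * R) : \bar R :=
  `|p.1.1.2|%:E * (\1_(farey_overlap T T') (p.1.1.2, p.1.2, p.2, p.1.1.1))%:E.
have mf : measurable_fun setT f.
  pose X4 := (borelX2 R * R * R * R)%type.
  pose X3 := (borelX2 R * R * R)%type; pose X2R := (borelX2 R * R)%type.
  have m12 := measurableT_comp (@measurable_fst _ _ X2R R) (@measurable_fst _ _ X3 R).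
  have m1 : measurable_fun [set: X4] (fun p : X4 => p.1.1.1).
    exact: (measurableT_comp (@measurable_fst _ _ (borelX2 R) R) m12).
  have m2 : measurable_fun [set: X4] (fun p : X4 => p.1.1.2).
    exact: (measurableT_comp (@measurable_snd _ _ (borelX2 R) R) m12).
  have m3 : measurable_fun [set: X4] (fun p : X4 => p.1.2).
    exact: (measurableT_comp (@measurable_snd _ _ X2R R) (@measurable_fst _ _ X3 R)).
  have m4 : measurable_fun [set: X4] (fun p : X4 => (p.1.1.2, p.1.2)).
    exact: (measurable_fun_pair m2 m3).
  have m5 : measurable_fun [set: X4] (fun p : X4 => (p.1.1.2, p.1.2, p.2)).
    exact: (measurable_fun_pair m4 (@measurable_snd _ _ X3 R)).
  have m6 : measurable_fun [set: X4] (fun p : X4 => (p.1.1.2, p.1.2, p.2, p.1.1.1)).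
    exact: (measurable_fun_pair m5 m1).
  apply: emeasurable_funM; apply/measurable_EFinP.
    exact: (measurableT_comp (@normr_measurable R setT) m2).
  exact: (measurableT_comp (measurable_indic (measurable_farey_overlap T T')) m6).
have f0 p : 0 <= f p by rewrite mule_ge0// lee_fin.
transitivity (\int[mu2]_L \int[leb]_b \int[leb]_c \int[leb]_a f (L, b, c, a)).
  rewrite (fubini_tonelli_leb3 mu2 mf f0).
  apply: eq_integral => b _; apply: eq_integral => c _; apply: eq_integral => a _.
  rewrite /f /= ge0_integralZl_EFin//; last first.
    apply/measurable_EFinP; apply: measurableT_comp => //.
    by apply: measurable_indic; exact: measurable_farey_overlap.
  congr (_ * _); transitivity (\int[mu2]_L (\1_(xsection (farey_overlap T T') (b, c, a)) L)%:E).
    rewrite integral_indic ?setIT//.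
    exact: measurable_xsection (measurable_farey_overlap _ _).
  by apply: eq_integral => L _; rewrite !indicE mem_xsection.
transitivity (\int[mu2]_L ((\1_[set L : borelX2 R | (F11 L <= T)%R] L)%:E * gap_integral T')).
  by apply: eq_integral => L _; exact: integral_farey_overlap.
rewrite ge0_integralZr//; last 2 first.
- by apply/measurable_EFinP; apply: measurable_indic; exact: measurable_F11_le.
- apply: integral_ge0 => x _; apply: integral_ge0 => x' _.
  by rewrite lee_fin gap_density_ge0.
by rewrite integral_indic ?setIT//; exact: measurable_F11_le.
Qed.

Lemma F11_law_proportional T T' :
  mu2 [set L | (F11 L <= T)%R] * gap_integral T' =
  mu2 [set L | (F11 L <= T')%R] * gap_integral T.
Proof.
rewrite -!leb_mu2_overlapE /leb_mu2_overlap.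
pose f t := `|t.1.1|%:E * mu2 (xsection (farey_overlap T' T) t).
have mf : measurable_fun setT f.
  apply: emeasurable_funM.
    apply/measurable_EFinP; apply: (measurableT_comp (@normr_measurable R setT)).
    exact: (measurableT_comp (@measurable_fst _ _ R R) (@measurable_fst _ _ (R * R)%type R)).
  exact: measurable_fun_xsection (measurable_farey_overlap _ _).
have f0 t : 0 <= f t by rewrite mule_ge0.
transitivity (\int[leb]_b \int[leb]_c \int[leb]_a f (lul_inv (b, c, a))).
  apply: eq_integral => b _; apply: eq_integral => c _; apply: eq_integral => a _.
  by rewrite xsection_overlap_lul_inv /f /lul_inv /= normrN.
exact: integral_lul_inv.
Qed.

End F11_law.

(** * Riemann sums of the gap density, as integrals of step functions *)

Section riemann_sum.
Variable R : realType.
Implicit Types (T h x : R) (f : R -> \bar R).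
Local Notation leb := (@lebesgue_measure R).

(* This is 0 for x < 0, where truncn is 0. *)
Definition lower_step h x : R := h * (Num.truncn (x / h))%:R.

Lemma lower_step_le h x : 0 < h -> 0 <= x -> lower_step h x <= x.
Proof.
by move=> h0 x0; rewrite /lower_step mulrC -ler_pdivlMr// truncn_le divr_ge0// ltW.
Qed.

Lemma lower_step_gt h x : 0 < h -> x - h < lower_step h x.
Proof.
move=> h0; have := truncnS_gt (x / h); rewrite ltr_pdivrMr// mulrC.
by rewrite -natr1 mulrDr mulr1 /lower_step ltrBlDr.
Qed.

Lemma measurable_lower_step h : 0 < h -> measurable_fun setT (lower_step h).
Proof.
move=> h0; apply: nondecreasing_measurable => // x y xy.
by rewrite /lower_step ler_pM2l// ler_nat le_truncn// ler_pM2r// invr_gt0.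
Qed.

Local Open Scope ereal_scope.

(** The condition f 0 = 0 matters beyond the first cell: the step 0 is also taken on the whole
    negative half-line, which has infinite measure. *)
Lemma integral_lower_step h f N : (0 < h)%R -> (forall x, 0 <= f x) ->
  f 0%R = 0 -> (forall m, (N <= m)%N -> f (h * m%:R)%R = 0) ->
  \int[leb]_x f (lower_step h x) = \sum_(m < N) h%:E * f (h * m%:R)%R.
Proof.
move=> h0 f0 f00 fN.
pose I (m : nat) : set R := [set` `[h * m%:R, h * m.+1%:R[%R].
have IE m x : (0 <= x)%R -> (x \in I m) = (Num.truncn (x / h) == m).
  move=> x0; rewrite truncn_eq ?divr_ge0 ?(ltW h0)//.
  by rewrite ler_pdivlMr// ltr_pdivrMr// !(mulrC _ h) mem_setE in_itv.
have IN m x : (x < 0)%R -> (x \in I m) = false.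
  move=> x0; apply/negbTE; rewrite mem_setE in_itv /= negb_and -ltNge.
  by rewrite (lt_le_trans x0)// mulr_ge0// ltW.
transitivity (\int[leb]_x \sum_(m < N) (f (h * m%:R)%R * (\1_(I m) x)%:E)).
  apply: eq_integral => x _; have [x0|x0] := ltP x 0%R.
    rewrite /lower_step truncn_floor leNgt pmulr_llt0 ?invr_gt0// x0 /= mulr0 f00.
    by rewrite big1// => m _; rewrite indicE IN// mule0.
  have [mN|mN] := ltnP (Num.truncn (x / h)) N.
    rewrite (bigD1 (Ordinal mN))//= indicE IE// eqxx mule1 big1 ?adde0// => i iN.
    rewrite indicE IE// (_ : _ == _ = false) ?mule0//.
    by apply: contraNF iN => /eqP iE; apply/eqP/val_inj.
  rewrite /lower_step fN// big1// => i _; rewrite indicE IE// gtn_eqF ?mule0//.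
  exact: leq_trans mN.
rewrite ge0_integral_sum//; last 2 first.
- move=> m; apply: measurable_funeM; apply/measurable_EFinP.
  by apply: measurable_indic; exact: measurable_itv.
- by move=> m x _; rewrite mule_ge0// lee_fin.
apply: eq_bigr => m _; rewrite ge0_integralZl//; last first.
  by apply/measurable_EFinP; apply: measurable_indic; exact: measurable_itv.
rewrite integral_indic ?setIT//; last exact: measurable_itv.
have /= -> : leb (I m) = h%:E.
  rewrite lebesgue_measure_itv /= lte_fin ltr_pM2l// ltr_nat leqnn.
  by rewrite -EFinB -mulrBr -natrB// subSnn mulr1.
by rewrite muleC.
Qed.

End riemann_sum.

Section riemann_sum_cvg.
Variable R : realType.
Variable T : R.
Local Notation leb := (@lebesgue_measure R).

Definition gap_riemann_sum (h : R) (N : nat) : R :=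
  h ^+ 2 * \sum_(m < N) \sum_(n < N) gap_density T (h * m%:R) (h * n%:R).

Lemma gap_density_out x x' : (x <= 0) || (T < x) || (x' <= 0) || (T < x') ->
  gap_density T x x' = 0.
Proof.
rewrite /gap_density /farey_triangle; case: ifPn => // /and5P[x0 xT x'0 x'T _].
by rewrite !ltNge xT x'T /= !orbF; move=> /orP[]; rewrite leNgt ?x0 ?x'0.
Qed.

Let F h (z : R * R) : \bar R := (gap_density T (lower_step h z.1) (lower_step h z.2))%:E.

Let mF h : 0 < h -> measurable_fun [set: R * R] (F h).
Proof.
move=> h0; apply/measurable_EFinP; apply: measurable_gap_density.
  exact: (measurableT_comp (measurable_lower_step h0) measurable_fst).
exact: (measurableT_comp (measurable_lower_step h0) measurable_snd).
Qed.

Let F_ge0 h z : (0 <= F h z)%E.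
Proof. by rewrite lee_fin gap_density_ge0. Qed.

Let FE h N : 0 < h -> T < h * N%:R ->
  (\int[leb \x leb]_z F h z = (gap_riemann_sum h N)%:E)%E.
Proof.
move=> h0 TN.
have -> : (\int[leb \x leb]_z F h z = \int[leb]_x \int[leb]_x' F h (x, x'))%E.
  exact: (@fubini_tonelli1 _ _ _ _ _ leb leb (F h) (mF h0) (F_ge0 h)).
have out m : (N <= m)%N -> T < h * m%:R.
  by move=> Nm; apply: (lt_le_trans TN); rewrite ler_pM2l// ler_nat.
pose G y := (\int[leb]_x' (gap_density T y (lower_step h x'))%:E)%E.
have GE y : (G y = (\sum_(n < N) h * gap_density T y (h * n%:R))%:E)%E.
  rewrite /G (@integral_lower_step R h (fun x' => (gap_density T y x')%:E) N)//.
  - by rewrite -sumEFin.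
  - by move=> x; rewrite lee_fin gap_density_ge0.
  - by rewrite gap_density_out// lexx !orbT.
  - by move=> m Nm; rewrite gap_density_out// out// !orbT.
transitivity (\int[leb]_x G (lower_step h x))%E; first by [].
rewrite (@integral_lower_step R h G N)//.
- rewrite /gap_riemann_sum mulr_sumr -sumEFin; apply: eq_bigr => m _.
  by rewrite GE -EFinM -mulr_sumr mulrA expr2.
- by move=> x; rewrite GE lee_fin sumr_ge0// => i _; rewrite mulr_ge0 ?gap_density_ge0// ltW.
- by rewrite GE big1// => i _; rewrite gap_density_out ?mulr0// lexx.
- by move=> m Nm; rewrite GE big1// => i _; rewrite gap_density_out ?mulr0//;
  apply/orP; left; apply/orP; left; apply/orP; right; exact: out.
Qed.

(** The convergence holds at every point, boundary included, because steps approach x and x' from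
    below: x = T keeps the steps at most T, and x + x' = T keeps their sum at most T, where the
    density is 0. *)
Let gap_lower_step_cvg (u : nat -> R) x x' : (forall n, 0 < u n) -> u n @[n --> \oo] --> 0 ->
  gap_density T (lower_step (u n) x) (lower_step (u n) x') @[n --> \oo] --> gap_density T x x'.
Proof.
move=> u0 cu.
have u_lt e : 0 < e -> \forall n \near \oo, u n < e by move=> e0; exact: cvgr_lt cu _ e0.
have step_cvg y : 0 <= y -> lower_step (u n) y @[n --> \oo] --> y.
  move=> y0; apply: (@squeeze_cvgr _ _ _ _ (fun n => y - u n) (fun=> y)).
  - apply: nearW => n; apply/andP; split; first exact/ltW/lower_step_gt.
    exact: lower_step_le.
  - by rewrite -[X in _ --> X]subr0; apply: cvgB => //; exact: cvg_cst.
  - exact: cvg_cst.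
have out0 : (\forall n \near \oo, gap_density T (lower_step (u n) x) (lower_step (u n) x') = 0) ->
    gap_density T x x' = 0 ->
    gap_density T (lower_step (u n) x) (lower_step (u n) x') @[n --> \oo] --> gap_density T x x'.
  move=> h ->; apply: cvg_near_cst; exact: h.
have neg0 y : y <= 0 -> forall n, lower_step (u n) y = 0.
  move=> y0 n; rewrite /lower_step truncn_floor; case: ifPn => [h|]; last by rewrite mulr0.
  have -> : y = 0 by apply/eqP; rewrite eq_le y0 -(pmulr_lge0 _ (_ : 0 < (u n)^-1))// invr_gt0.
  by rewrite mul0r floor0 mulr0.
have [x0|x0] := leP x 0.
  apply: out0; last by rewrite gap_density_out// x0.
  by apply: nearW => n; rewrite gap_density_out// neg0// lexx.
have [x'0|x'0] := leP x' 0.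
  apply: out0; last by rewrite gap_density_out// x'0 !orbT.
  by apply: nearW => n; rewrite gap_density_out// (neg0 x')// lexx !orbT.
have [xT|xT] := ltP T x.
  apply: out0; last by rewrite gap_density_out// xT !orbT.
  have : 0 < x - T by rewrite subr_gt0.
  move/u_lt; apply: filterS => n un; rewrite gap_density_out//.
  by have := lower_step_gt x (u0 n) => h; rewrite (_ : T < _) ?orbT//; lra.
have [x'T|x'T] := ltP T x'.
  apply: out0; last by rewrite gap_density_out// x'T !orbT.
  have : 0 < x' - T by rewrite subr_gt0.
  move/u_lt; apply: filterS => n un; rewrite gap_density_out//.
  by have := lower_step_gt x' (u0 n) => h; rewrite (_ : T < lower_step _ x') ?orbT//; lra.
have cx := step_cvg _ (ltW x0); have cx' := step_cvg _ (ltW x'0).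
have [xx|xx] := leP (x + x') T.
  have E n : gap_density T (lower_step (u n) x) (lower_step (u n) x') = 0.
    have step_le : lower_step (u n) x + lower_step (u n) x' <= T.
      by apply: le_trans xx; apply: lerD; apply: lower_step_le => //; exact: ltW.
    by rewrite /gap_density /farey_triangle (ltNge T) step_le !andbF.
  apply: out0; first exact: nearW.
  by rewrite /gap_density /farey_triangle (ltNge T) xx !andbF.
pose k (z z' : R) := (Num.max 2^-1 (z * z'))^-1.
have -> : gap_density T x x' = k x x'.
  by rewrite /gap_density /farey_triangle x0 xT x'0 x'T xx.
apply: (@cvg_trans _ (k (lower_step (u n) x) (lower_step (u n) x') @[n --> \oo])).
  apply: near_eq_cvg.
  have h1 : \forall n \near \oo, 0 < lower_step (u n) x by exact: cvgr_gt cx _ x0.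
  have h2 : \forall n \near \oo, 0 < lower_step (u n) x' by exact: cvgr_gt cx' _ x'0.
  have h3 : \forall n \near \oo, T < lower_step (u n) x + lower_step (u n) x'.
    exact: cvgr_gt (cvgD cx cx') _ xx.
  near=> n; rewrite /gap_density /farey_triangle.
  have -> : 0 < lower_step (u n) x by near: n.
  have -> : 0 < lower_step (u n) x' by near: n.
  have -> : T < lower_step (u n) x + lower_step (u n) x' by near: n.
  by rewrite (le_trans (lower_step_le _ (ltW x0)) xT)// (le_trans (lower_step_le _ (ltW x'0)) x'T).
apply: cvgV; first by rewrite gt_eqF// lt_max invr_gt0 ltr0n.
apply: (@continuous_cvg _ _ _ _ _ _ (fun w : R => Num.max 2^-1 w)).
  by apply: (@continuous_max _ _ (fun=> 2^-1) id); [exact: cst_continuous|exact: cvg_id].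
exact: cvgM.
Unshelve. all: by end_near. Qed.

Let f (z : R * R) : \bar R := (gap_density T z.1 z.2)%:E.

Let mf : measurable_fun [set: R * R] f.
Proof. by apply/measurable_EFinP; exact: measurable_gap_density. Qed.

Let f_ge0 z : (0 <= f z)%E.
Proof. by rewrite lee_fin gap_density_ge0. Qed.

(** A common support for all mesh sizes h: if the step of y is positive and at most T, then h <= T
    and y < T + h <= 2 T. *)
Let square : set (R * R) := `[0, 2 * T]%classic `*` `[0, 2 * T]%classic.

Let bound (z : R * R) : \bar R := (2%:E * (\1_square z)%:E)%E.

Let msquare : measurable square.
Proof. by apply: measurableX; exact: measurable_itv. Qed.

Let mbound : measurable_fun [set: R * R] bound.
Proof.
by apply: measurable_funeM; apply/measurable_EFinP; exact: measurable_indic.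
Qed.

Let bound_integrable : (leb \x leb)%E.-integrable setT bound.
Proof.
apply/integrableP; split; first exact: mbound.
have -> : (\int[leb \x leb]_z `|bound z| = \int[leb \x leb]_z bound z)%E.
  by apply: eq_integral => z _; rewrite gee0_abs// mule_ge0// lee_fin.
have -> : (\int[leb \x leb]_z bound z = 2%:E * \int[leb \x leb]_z (\1_square z)%:E)%E.
  by apply: ge0_integralZl => //; apply/measurable_EFinP; exact: (measurable_indic msquare).
rewrite lte_mul_pinfty// ?lee_fin//.
have -> : (\int[leb \x leb]_x (\1_square x)%:E = (leb \x leb) (square `&` setT))%E.
  exact: integral_indic.
have -> : square `&` setT = square by exact: setIT.
have -> : ((leb \x leb) square = leb `[0%R, (2 * T)%R] * leb `[0%R, (2 * T)%R])%E.
  by apply: product_measure1E; exact: measurable_itv.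
by rewrite lebesgue_measure_itv /=; case: ifP => _; rewrite ?mule0 ?ltry// -!EFinB -EFinM ltry.
Qed.

Let F_bound h z : 0 < h -> (`|F h z| <= bound z)%E.
Proof.
move=> h0; rewrite /F /bound abse_EFin ger0_norm ?gap_density_ge0// -EFinM lee_fin indicE.
have [/set_mem zs|/negP zs] := boolP (z \in square).
  by rewrite mulr1 gap_density_le2.
rewrite mulr0 /gap_density; case: ifPn => // /and5P[x0 xT x'0 x'T _].
have step_in y : 0 < lower_step h y -> lower_step h y <= T -> `[0, 2 * T]%classic y.
  move=> y0 yT; have y_gt0 : 0 <= y.
    rewrite leNgt; apply/negP => yn; move: y0; rewrite /lower_step truncn_floor.
    by rewrite leNgt pmulr_llt0 ?invr_gt0// yn /= mulr0 ltxx.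
  have hT : h <= T.
    apply: le_trans yT; rewrite /lower_step ler_peMr ?(ltW h0)//.
    rewrite ler1n lt0n; apply/negP => /eqP k0.
    by move: y0; rewrite /lower_step k0 mulr0 ltxx.
  by rewrite /= in_itv /= y_gt0 /=; have := lower_step_gt y h0; lra.
by exfalso; apply: zs; apply/mem_set; split; exact: step_in.
Qed.

Let fE : (\int[leb \x leb]_z f z = gap_integral T)%E.
Proof. exact: (@fubini_tonelli1 _ _ _ _ _ leb leb f mf f_ge0). Qed.

Let dct (u : nat -> R) : (forall n, 0 < u n) -> u n @[n --> \oo] --> 0 ->
  (leb \x leb)%E.-integrable setT f /\
  (\int[leb \x leb]_z F (u n) z)%E @[n --> \oo] --> gap_integral T.
Proof.
move=> u0 cu.
have [|||||] := @dominated_convergence _ _ R (leb \x leb)%E setT measurableT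
  (fun n => F (u n)) f bound.
- by move=> n; exact: mF.
- exact: mf.
- by apply: aeW => z _; apply: cvg_EFin; [exact: nearW|exact: gap_lower_step_cvg].
- exact: bound_integrable.
- by apply: aeW => z n _; exact: F_bound.
- by move=> fint _; rewrite fE.
Qed.

Lemma gap_integral_fin_num : gap_integral T \is a fin_num.
Proof.
have [fint _] := dct (fun n => ltac:(by rewrite invr_gt0) : 0 < n.+1%:R^-1 :> R) cvg_harmonic.
by rewrite -fE; exact: integrable_fin_num.
Qed.

Lemma gap_riemann_sum_cvg e : 0 < e -> exists2 d, 0 < d & forall h N,
  0 < h -> h < d -> T < h * N%:R ->
  `|gap_riemann_sum h N - fine (gap_integral T)| < e.
Proof.
move=> e0.
(* All N with T < h N give the integral of the same step function, so one choice of N makes the sum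
   a function of h alone. *)
pose S h := gap_riemann_sum h (Num.truncn (T / h)).+1.
have valid h : 0 < h -> T < h * (Num.truncn (T / h)).+1%:R.
  by move=> h0; rewrite mulrC -ltr_pdivrMr//; exact: truncnS_gt.
have : S h @[h --> 0^'+] --> fine (gap_integral T).
  apply/cvg_at_rightP => u [u0 cu].
  have -> : (fun n => S (u n)) = fine \o (fun n => \int[leb \x leb]_z F (u n) z)%E.
    by apply/funext => n /=; rewrite (FE (u0 n) (valid _ (u0 n))).
  apply: fine_cvg; rewrite fineK ?gap_integral_fin_num//.
  exact: (dct u0 cu).2.
move/cvgrPdist_lt => /(_ _ e0)[d /= d0 dS]; exists d => // h N h0 hd TN.
have -> : gap_riemann_sum h N = S h.
  by apply: EFin_inj; rewrite -(FE h0 TN) -(FE h0 (valid _ h0)).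
have hd' : ball_ (fun x : R => `|x|) 0 d h by rewrite /ball_ /= sub0r normrN gtr0_norm.
by rewrite distrC; exact: (dS h hd' h0).
Qed.

End riemann_sum_cvg.

(** * From sums over all pairs to sums over coprime pairs *)

Section inverse_squares.
Variable R : realType.

Definition inv_sq_sum (N : nat) : R := \sum_(1 <= d < N) d%:R ^- 2.

(** The bound telescopes: 1/(y - 1/2) - 1/(y + 1/2) = 1/(y^2 - 1/4). The shift by 1/2 gives 2/3 for
    the tail from 2, where 1/(y - 1) - 1/y would give 1, too much for a contraction. *)
Lemma inv_sq_sum_tail (a N : nat) : (0 < a)%N ->
  \sum_(a <= d < N) (d%:R ^- 2 : R) <= (a%:R - 2^-1)^-1.
Proof.
move=> a0; have pos k : (0 < k)%N -> 0 < k%:R - 2^-1 :> R.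
  by rewrite -(ler1n R) => k0; lra.
have [Na|aN] := leqP N a; first by rewrite big_geq// invr_ge0 ltW// pos.
suff : \sum_(a <= d < N) (d%:R ^- 2 : R) <= (a%:R - 2^-1)^-1 - (N%:R - 2^-1)^-1.
  move/le_trans; apply; rewrite gerBl invr_ge0 ltW// pos//.
  exact: leq_trans (ltnW aN).
rewrite -(subnKC (ltnW aN)); elim: (N - a)%N => [|k IH].
  by rewrite addn0 big_geq// subrr.
rewrite addnS big_nat_recr ?leq_addr//=; apply: (le_trans (lerD IH (lexx _))).
set n := (a + k)%N; have n0 : (0 < n)%N by rewrite ltn_addr.
have := pos _ n0; have := pos _ (ltn0Sn n); rewrite -natr1.
set y : R := n%:R => y1 y0.
have yy : 0 < y by lra.
have : y ^- 2 <= (y - 2^-1)^-1 - (y + 1 - 2^-1)^-1.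
  have -> : (y - 2^-1)^-1 - (y + 1 - 2^-1)^-1 = ((y - 2^-1) * (y + 1 - 2^-1))^-1.
    have a_neq0 := lt0r_neq0 y0; have b_neq0 := lt0r_neq0 y1.
    apply: (mulIf (mulf_neq0 a_neq0 b_neq0)); rewrite mulVf ?mulf_neq0//.
    by rewrite mulrBl mulKf// mulrCA mulVf//; lra.
  have p0 : 0 < (y - 2^-1) * (y + 1 - 2^-1) by rewrite mulr_gt0.
  rewrite lef_pV2 ?posrE ?exprn_gt0//.
  have -> : (y - 2^-1) * (y + 1 - 2^-1) = y ^+ 2 - 4^-1 by field.
  lra.
lra.
Qed.

Lemma inv_sq_sum_cvg : cvgn inv_sq_sum.
Proof.
apply: nondecreasing_is_cvgn.
  apply/nondecreasing_seqP => n; rewrite /inv_sq_sum; case: n => [|n].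
    by rewrite !big_geq.
  by rewrite [leRHS]big_nat_recr//= lerDl invr_ge0 exprn_ge0.
exists 2 => _ [n _ <-]; apply: (le_trans (inv_sq_sum_tail n (ltn0Sn 0))).
have -> : 1%:R - 2^-1 = 2^-1 :> R by lra.
by rewrite invrK.
Qed.

Lemma inv_sq_sum_lim_gt0 : 0 < limn inv_sq_sum.
Proof.
apply: (@lt_le_trans _ _ (inv_sq_sum 2)); first by rewrite /inv_sq_sum big_nat1 expr1n invr1.
apply: nondecreasing_cvgn_le; last exact: inv_sq_sum_cvg.
apply/nondecreasing_seqP => n; rewrite /inv_sq_sum; case: n => [|n].
  by rewrite !big_geq.
by rewrite [leRHS]big_nat_recr//= lerDl invr_ge0 exprn_ge0.
Qed.

(* Since sum_(d >= 2) d^-2 < 1, the relation below, solved for the term d = 1,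
   is a contraction for the limsup of |r| at 0. *)
Lemma contraction_cvg0 (r : R -> R) (B : R) (N : R -> nat) :
  (forall h, 0 < h -> `|r h| <= B) ->
  (forall e, 0 < e -> exists2 d, 0 < d & forall h, 0 < h -> h < d ->
     (1 < N h)%N /\ `|\sum_(1 <= k < N h) k%:R ^- 2 * r (k%:R * h)| < e) ->
  forall e, 0 < e -> exists2 d, 0 < d & forall h, 0 < h -> h < d -> `|r h| < e.
Proof.
move=> rB rN.
have B0 : 0 <= B by apply: le_trans (rB 1 ltr01).
have step A h0 : 0 < A -> 0 < h0 -> (forall h, 0 < h -> h < h0 -> `|r h| <= A) ->
    exists2 h1, 0 < h1 & forall h, 0 < h -> h < h1 -> `|r h| <= 7 / 8 * A.
  move=> A0 h00 rA.
  (* The terms 2 <= k <= K have k h < h0 and add up to at most 2/3 A. Those with k > K have only the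
     a priori bound B, and K makes them at most A/16. With the error A/16 the total is below 7/8
     A. *)
  have [d d0 rd] := rN (A / 16) (ltac:(by rewrite divr_gt0)).
  pose K := (Num.truncn (16 * B / A)).+1.
  have K0 : 0 < K%:R :> R by rewrite ltr0n.
  have BK : B / K%:R <= A / 16.
    have := truncnS_gt (16 * B / A); rewrite -/K ltr_pdivrMr// => hK.
    rewrite ler_pdivrMr//; lra.
  exists (Num.min d (h0 / K.+1%:R)); first by rewrite lt_min d0 divr_gt0.
  move=> h h_gt0; rewrite lt_min => /andP[hd hK].
  have [N1 sumlt] := rd h h_gt0 hd.
  rewrite big_ltn// expr1n invr1 !mul1r in sumlt.
  have tail : `|\sum_(2 <= k < N h) k%:R ^- 2 * r (k%:R * h)| <=
      \sum_(2 <= k < N h) k%:R ^- 2 * A + \sum_(K.+1 <= k < N h) k%:R ^- 2 * B.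
    apply: (le_trans (ler_norm_sum _ _ _)).
    have -> : \sum_(K.+1 <= k < N h) k%:R ^- 2 * B =
        \sum_(2 <= k < N h) (if (K < k)%N then k%:R ^- 2 * B else 0).
      by rewrite -big_mkcond /= (big_nat_widenl K.+1 2).
    rewrite -big_split /= !big_nat; apply: ler_sum => k /andP[k2 _].
    have k0 : 0 < k%:R :> R by rewrite ltr0n (leq_trans _ k2).
    rewrite normrM ger0_norm ?invr_ge0 ?exprn_ge0//.
    case: ltnP => kK.
      rewrite -mulrDr ler_wpM2l ?invr_ge0 ?exprn_ge0//.
      by apply: (le_trans (rB _ _)); [exact: mulr_gt0|lra].
    rewrite addr0 ler_wpM2l ?invr_ge0 ?exprn_ge0//; apply: rA; first exact: mulr_gt0.
    apply: le_lt_trans (_ : K%:R * h < _).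
      by rewrite ler_pM2r// ler_nat.
    apply: le_lt_trans (_ : K.+1%:R * h < _); last by rewrite mulrC -ltr_pdivlMr.
    by rewrite ler_pM2r// ler_nat.
  have t1 := inv_sq_sum_tail (N h) (ltn0Sn 1).
  have t2 := inv_sq_sum_tail (N h) (ltn0Sn K).
  rewrite -!mulr_suml in tail.
  have T1 : (\sum_(2 <= k < N h) k%:R ^- 2) * A <= 2 / 3 * A.
    rewrite ler_pM2r//; apply: (le_trans t1).
    have -> : 2%:R - 2^-1 = 3 / 2 :> R by lra.
    by rewrite invf_div.
  have T2 : (\sum_(K.+1 <= k < N h) k%:R ^- 2) * B <= A / 16.
    apply: le_trans BK; rewrite mulrC ler_wpM2l//; apply: (le_trans t2).
    by rewrite lef_pV2 ?posrE// -natr1; lra.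
  have := ler_normB (r h + \sum_(2 <= k < N h) k%:R ^- 2 * r (k%:R * h)) (\sum_(2 <= k < N h) k%:R ^- 2 * r (k%:R * h)).
  rewrite addrK => h1; lra.
have iterate n : exists2 h0, 0 < h0 & forall h, 0 < h -> h < h0 -> `|r h| <= (7 / 8) ^+ n * (B + 1).
  elim: n => [|n [h0 h00 IH]].
    exists 1 => // h h0 _; rewrite expr0 mul1r; apply: (le_trans (rB _ h0)); lra.
  rewrite exprS -mulrA; apply: (step _ h0) => //.
  by rewrite mulr_gt0 ?exprn_gt0 ?divr_gt0//; lra.
move=> e e0.
have [n ne] : exists n, (7 / 8) ^+ n * (B + 1) < e.
  have B1 : 0 < B + 1 by lra.
  have : (7 / 8 : R) ^+ n @[n --> \oo] --> 0 by apply: cvg_expr; rewrite ger0_norm; lra.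
  move/cvgr_lt => /(_ (e / (B + 1)))[|n _ nP]; first exact: divr_gt0.
  by exists n; rewrite -ltr_pdivlMr//; exact: (nP n (leqnn n)).
have [h0 h00 rh] := iterate n; exists h0 => // h h_gt0 hh.
exact: le_lt_trans (rh _ h_gt0 hh) ne.
Qed.

End inverse_squares.

Lemma sum_gcdn (V : nmodType) (G : nat -> nat -> V) (N : nat) :
  (forall m n, [|| m == 0, n == 0, N <= m | N <= n]%N -> G m n = 0) ->
  \sum_(m < N) \sum_(n < N) G m n =
  \sum_(1 <= d < N) \sum_(q < N) \sum_(r < N | coprime q r) G (d * q)%N (d * r)%N.
Proof.
case: N => [|N] G0; first by rewrite big_ord0 big_geq.
rewrite (big_nat_widenl 1 0)// big_mkord /=.
under [RHS]eq_bigr do rewrite pair_big_dep.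
rewrite pair_bigA [RHS]pair_big_dep /=.
pose I := 'I_N.+1.
(* The other triples, with a zero coordinate or a product out of range, contribute 0 by [G0]; on
   these, [inord] in [p] below does not truncate. *)
pose ok (t : I * (I * I)) := [&& 0 < t.2.1, 0 < t.2.2, t.1 * t.2.1 < N.+1 & t.1 * t.2.2 < N.+1]%N.
rewrite [RHS](bigID ok) /= [X in _ + X]big1 ?addr0; last first.
  move=> t /andP[/andP[t1 _] ntok]; apply: G0; apply: contraR ntok.
  rewrite !negb_or -!ltnNge !muln_eq0 !negb_or -!lt0n /ok.
  by case/and4P => /andP[_ ->] /andP[_ ->] -> ->.
pose p (t : I * (I * I)) : I * I := (inord (t.1 * t.2.1), inord (t.1 * t.2.2)).
rewrite [RHS](partition_big p xpredT)//=; apply: eq_bigr => -[m n] _ /=.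
have pE t : ok t -> p t == (m, n) -> (t.1 * t.2.1 = m)%N /\ (t.1 * t.2.2 = n)%N.
  case/and4P=> _ _ t1 t2 /eqP[/(congr1 val) + /(congr1 val)].
  by rewrite /= !inordK.
have [mn0|] := boolP ((m == 0%N :> nat) || (n == 0%N :> nat)).
  have Gmn : G m n = 0 by apply: G0; case/orP: mn0 => ->; rewrite ?orbT.
  by rewrite Gmn big1// => t /andP[/andP[_ tok] /(pE _ tok)[-> ->]].
rewrite negb_or -!lt0n => /andP[m0 n0].
have g0 : (0 < gcdn m n)%N by rewrite gcdn_gt0 m0.
have gm : (gcdn m n <= m)%N by rewrite dvdn_leq// dvdn_gcdl.
have bound (k l : nat) : (k < N.+1)%N -> (k %/ l < N.+1)%N.
  by move=> kN; apply: leq_ltn_trans kN; exact: leq_div.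
pose t0 : I * (I * I) := (inord (gcdn m n), (inord (m %/ gcdn m n), inord (n %/ gcdn m n))).
have t01 : t0.1 = gcdn m n :> nat by rewrite inordK// (leq_ltn_trans gm).
have t02 : t0.2.1 = (m %/ gcdn m n)%N :> nat by rewrite inordK// bound.
have t03 : t0.2.2 = (n %/ gcdn m n)%N :> nat by rewrite inordK// bound.
have mE : (t0.1 * t0.2.1 = m)%N by rewrite t01 t02 mulnC divnK// dvdn_gcdl.
have nE : (t0.1 * t0.2.2 = n)%N by rewrite t01 t03 mulnC divnK// dvdn_gcdr.
rewrite (big_pred1 t0) /= ?mE ?nE// => t; apply/idP/eqP.
  move=> /andP[/andP[/andP[d0 cop] tok] /(pE _ tok)[tm tn]].
  have tg : t.1 = gcdn m n :> nat by rewrite -tm -tn -muln_gcdr (eqP cop) muln1.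
  case: t d0 cop tok tm tn tg => d [q r] /= d0 cop tok tm tn tg.
  rewrite /t0 -tg; congr (_, (_, _)); apply/val_inj; rewrite /= inordK//.
  - by rewrite -tm mulKn.
  - by rewrite bound.
  - by rewrite -tn mulKn.
  - by rewrite bound.
have cop : coprime t0.2.1 t0.2.2.
  rewrite t02 t03 /coprime -(eqn_pmul2l g0) muln1 muln_gcdr !(mulnC (gcdn m n)).
  by rewrite !divnK ?dvdn_gcdl ?dvdn_gcdr.
move=> ->; apply/andP; split; last by rewrite /p mE nE !inord_val.
rewrite cop /ok mE nE !ltn_ord t01 g0 t02 t03 !divn_gt0// gm.
by rewrite dvdn_leq// dvdn_gcdr.
Qed.

Section coprime_sum.
Variables (R : realType) (T : R).
Hypothesis T_gt0 : 0 < T.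

Definition coprime_gap_sum (h : R) (N : nat) : R :=
  h ^+ 2 * \sum_(q < N) \sum_(r < N | coprime q r)
    gap_density T (h * q%:R) (h * r%:R).

Lemma coprime_gap_sum_widen h N M : 0 < h -> T < h * N%:R -> (N <= M)%N ->
  coprime_gap_sum h N = coprime_gap_sum h M.
Proof.
move=> h0 TN NM; congr (_ * _).
have out m : (N <= m)%N -> T < h * m%:R.
  by move=> Nm; apply: (lt_le_trans TN); rewrite ler_pM2l// ler_nat.
rewrite (big_ord_widen _ (fun q => \sum_(r < N | coprime q r) gap_density T (h * q%:R) (h * r%:R)) NM).
rewrite [LHS]big_mkcond; apply: eq_bigr => q _; case: ltnP => [qN|Nq].
  rewrite (big_ord_widen_cond _ (fun r => coprime q r) (fun r => gap_density T (h * q%:R) (h * r%:R)) NM).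
  rewrite big_mkcondr; apply: eq_bigr => r _; case: ltnP => // Nr.
  by rewrite gap_density_out// (out r)// !orbT.
by rewrite big1// => r _; rewrite gap_density_out// (out q)// !orbT.
Qed.

(** Pairs of gcd d sample the density along coprime pairs with mesh d h, and h^2 = d^-2 (d h)^2. *)
Lemma gap_riemann_sum_coprime h N : 0 < h -> T < h * N%:R ->
  gap_riemann_sum T h N =
  \sum_(1 <= d < N) d%:R ^- 2 * coprime_gap_sum (d%:R * h) N.
Proof.
move=> h0 TN; rewrite /gap_riemann_sum.
rewrite (@sum_gcdn _ (fun m n => gap_density T (h * m%:R) (h * n%:R)) N); last first.
  have out m : (N <= m)%N -> T < h * m%:R.
    by move=> Nm; apply: (lt_le_trans TN); rewrite ler_pM2l// ler_nat.
  move=> m n /or4P[/eqP->|/eqP->|/out mn|/out mn]; apply: gap_density_out.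
  - by rewrite mulr0 lexx.
  - by rewrite mulr0 lexx !orbT.
  - by rewrite mn !orbT.
  - by rewrite mn !orbT.
rewrite mulr_sumr !big_nat; apply: eq_bigr => d /andP[d0 _].
have dR : d%:R != 0 :> R by rewrite pnatr_eq0 -lt0n.
rewrite /coprime_gap_sum exprMn mulrA mulrA mulVf ?expf_neq0// mul1r; congr (_ * _).
apply: eq_bigr => q _; apply: eq_bigr => r _.
by rewrite !natrM; congr (gap_density _ _ _); ring.
Qed.

Lemma coprime_gap_sum_ge0 h N : 0 <= coprime_gap_sum h N.
Proof.
rewrite mulr_ge0 ?sqr_ge0//; apply: sumr_ge0 => q _; apply: sumr_ge0 => r _.
exact: gap_density_ge0.
Qed.

Let N_ h := (Num.truncn (T / h)).+1.

Let N_P h : 0 < h -> T < h * (N_ h)%:R.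
Proof. by move=> h0; rewrite mulrC -ltr_pdivrMr//; exact: truncnS_gt. Qed.

Let D h := coprime_gap_sum h (N_ h).

Let DE h N : 0 < h -> T < h * N%:R -> coprime_gap_sum h N = D h.
Proof.
move=> h0 TN; rewrite (coprime_gap_sum_widen h0 TN (leq_maxl N (N_ h))).
by rewrite /D [RHS](coprime_gap_sum_widen h0 (N_P h0) (leq_maxr N (N_ h))).
Qed.

Let sum_le h (a : nat -> R) C : 0 < h -> 0 <= C -> a 0%N = 0 -> (forall r, a r <= C) ->
  h * \sum_(r < N_ h) a r <= T * C.
Proof.
move=> h0 C0 a0 aC; rewrite big_ord_recl /= a0 add0r.
apply: (@le_trans _ _ (h * ((Num.truncn (T / h))%:R * C))).
  rewrite ler_pM2l// mulr_natl -[X in _ *+ X]card_ord -sumr_const.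
  by apply: ler_sum => i _; exact: aC.
rewrite mulrA ler_wpM2r// mulrC -ler_pdivlMr// truncn_le.
by rewrite divr_ge0// ltW.
Qed.

Let D_le h : 0 < h -> D h <= T * (T * 2).
Proof.
move=> h0; rewrite /D /coprime_gap_sum expr2 -mulrA mulr_sumr.
apply: (@sum_le h (fun q => h * \sum_(r < N_ h | coprime q r) gap_density T (h * q%:R) (h * r%:R))) => //.
- by rewrite mulr_ge0// ltW.
- by rewrite big1 ?mulr0// => r _; apply: gap_density_out; rewrite ?mulr0 lexx.
- move=> q; rewrite big_mkcond /=.
  apply: (@sum_le h (fun r => if coprime q r then gap_density T (h * q%:R) (h * r%:R) else 0)) => //.
  + by case: ifP => // _; apply: gap_density_out; rewrite mulr0 lexx !orbT.
  + by move=> r; case: ifP => // _; exact: gap_density_le2.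
Qed.

(** Let r h be the error. The sum of k^-2 r (k h) is the error of the full Riemann sum plus J / z
    times the tail of the series of inverse squares. Both are small as h -> 0, since the range
    [N_ h] grows, and [contraction_cvg0] concludes. *)
Lemma coprime_gap_sum_cvg e : 0 < e -> exists2 d, 0 < d & forall h N,
  0 < h -> h < d -> T < h * N%:R ->
  `|coprime_gap_sum h N - fine (gap_integral T) / limn (@inv_sq_sum R)| < e.
Proof.
move=> e0; set z := limn _; set J := fine _.
have z0 : 0 < z by exact: inv_sq_sum_lim_gt0.
pose r h := D h - J / z.
have D0 h : 0 <= D h by exact: coprime_gap_sum_ge0.
have [||d d0 rd] := @contraction_cvg0 R r (T * (T * 2) + `|J / z|) N_ _ _ e e0.
- move=> h h0; apply: (le_trans (ler_normB _ _)); rewrite lerD2r ger0_norm//.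
  exact: D_le.
- move=> e' e'0.
  have e'2 : 0 < e' / 2 by rewrite divr_gt0.
  have [d1 d10 rs] := @gap_riemann_sum_cvg R T _ e'2.
  have [n0 zn0] : exists n0, forall n, (n0 <= n)%N -> `|J / z * (z - inv_sq_sum R n)| < e' / 2.
    have Jz : 0 < `|J / z| + 1 by rewrite ltr_pwDr.
    have /cvgrPdist_lt/(_ (e' / 2 / (`|J / z| + 1))) := inv_sq_sum_cvg (R := R).
    case; first exact: divr_gt0.
    move=> n0 _ n0P; exists n0 => n nn; rewrite normrM.
    have := n0P n nn; rewrite /= ltr_pdivlMr// mulrDr mulr1 => hn.
    by rewrite mulrC (le_lt_trans _ hn)// lerDl.
  pose d2 := Num.min d1 (T / (maxn 2 n0)%:R).
  exists d2; first by rewrite lt_min d10 divr_gt0// ltr0n leq_max.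
  move=> h h0; rewrite lt_min => /andP[hd1 hd2].
  have Nmax : (maxn 2 n0 < N_ h)%N.
    rewrite ltnS truncn_ge_nat ?divr_ge0// ?(ltW h0) ?(ltW T_gt0)//.
    rewrite ler_pdivlMr// mulrC -ler_pdivlMr ?ltr0n ?leq_max//.
    exact: ltW.
  split; first by apply: leq_ltn_trans Nmax; rewrite leq_max.
  have -> : \sum_(1 <= k < N_ h) k%:R ^- 2 * r (k%:R * h) =
     (gap_riemann_sum T h (N_ h) - J) + J / z * (z - inv_sq_sum R (N_ h)).
    rewrite (gap_riemann_sum_coprime h0 (N_P h0)) mulrBr divfK ?gt_eqF//.
    rewrite addrA subrK /inv_sq_sum mulr_sumr -sumrB !big_nat; apply: eq_bigr => k /andP[k0 kN].
    rewrite /r mulrBr (mulrC (J / z)); congr (_ * _ - _).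
    rewrite DE// ?mulr_gt0// ?ltr0n//; apply: (lt_le_trans (N_P h0)).
    by rewrite ler_wpM2r// ler_peMl ?ler1n// ltW.
  apply: (le_lt_trans (ler_normD _ _)); rewrite [ltRHS]splitr; apply: ltrD.
    exact: (rs _ _ h0 hd1 (N_P h0)).
  by apply: zn0; apply: ltnW; apply: leq_ltn_trans Nmax; rewrite leq_max leqnn orbT.
- exists d => // h N h0 hd TN.
  by rewrite (DE h0 TN); exact: rd.
Qed.

End coprime_sum.

(** * The set where h [qmin] <= T, cut into intervals indexed by coprime pairs *)

Section farey_horocycle.
Variable R : realType.
Implicit Types (h t T : R) (c : 'M[int]_2).
Local Notation leb := (@lebesgue_measure R).

Lemma lebesgue_preimage_mul (k : R) (A : set R) : k != 0 -> measurable A ->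
  (`|k|%:E * leb [set t | A (k * t)%R] = leb A)%E.
Proof.
move=> k0 mA.
have mf : measurable_fun [set: R] (fun x => (\1_A x)%:E : \bar R).
  by apply/measurable_EFinP; exact: measurable_indic.
have mkA : measurable [set t | A (k * t)].
  have mk : measurable_fun [set: R] (fun t => k * t) by exact: measurable_funM.
  by have := mk measurableT A mA; rewrite setTI.
have E (B : set R) : measurable B -> (leb B = \int[leb]_x (\1_B x)%:E)%E.
  move=> mB; have -> : leb B = leb (B `&` setT) by congr (leb _); rewrite setIT.
  by apply/esym; exact: (integral_indic leb measurableT mB).
rewrite (E _ mA) (E _ mkA).
have := @ge0_integral_affine R k 0 _ k0 mf (fun x => ltac:(by rewrite lee_fin)).
move=> <-; congr (_ * _)%E.
by apply: eq_integral => t _; rewrite addr0 !indicE; congr (_%:R%:E).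
Qed.

(* The lattice of [horo h t] consists of the (h q, (p - t q) / h), which is in C1 if
   and only if 0 < q and |p / q - t| < h^2. *)
Definition horo h t : 'M[R]_2 := \matrix_(i, j)
  if i == 0 then if j == 0 then h else 0 else if j == 0 then - t / h else h^-1.

(** The columns of c encode two fractions, with the denominators in the first row and the numerators
    in the second. *)
Definition farey_interval T h c : set R :=
  [set t | farey T (horo h t *m map_mx intr c)].

Lemma farey_intervalE T h c t : h != 0 ->
  let x := h * (c 0 0)%:~R in let x' := h * (c 0 1)%:~R in
  farey_interval T h c t <-> [/\ 0 < x <= T, 0 < x' <= T, T < x + x',
    `|(c 1 0)%:~R / h + - h ^- 2 * t * x| < x &
    x' <= (c 1 1)%:~R / h + - h ^- 2 * t * x'].
Proof.
move=> h0 x x'; rewrite /farey_interval /= /farey !mulmx22 !mxE /= !mul0r !addr0.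
have E (p q : int) : - t / h * p%:~R + h^-1 * q%:~R = q%:~R / h + - h ^- 2 * t * (h * p%:~R).
  by field.
by rewrite !E.
Qed.

(** As t varies the basis moves by the shear of parameter - t / h^2, so the length is h^2 times that
    of [lebesgue_shear_farey]. *)
Lemma lebesgue_farey_interval T h c : 0 < h -> \det c = 1 ->
  measurable (farey_interval T h c) /\
  leb (farey_interval T h c) =
    (h ^+ 2 * gap_density T (h * (c 0 0)%:~R) (h * (c 0 1)%:~R))%:E.
Proof.
move=> h0 dc; set x := h * _; set x' := h * _.
pose A := [set a | [/\ 0 < x <= T, 0 < x' <= T, T < x + x',
    `|(c 1 0)%:~R / h + a * x| < x & x' <= (c 1 1)%:~R / h + a * x']].
have mA : measurable A.
  apply: is_interval_measurable => a b [ax ax' axx a1 a2] [_ _ _ b1 b2] k /andP[ak kb].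
  have /andP[x0 _] := ax; have /andP[x'0 _] := ax'.
  split => //; last first.
    apply: (le_trans a2); rewrite lerD2l ler_pM2r//.
  move: a1 b1; rewrite !ltr_norml => /andP[a1 _] /andP[_ b1]; apply/andP; split.
    by apply: (lt_le_trans a1); rewrite lerD2l ler_pM2r.
  by apply: le_lt_trans b1; rewrite lerD2l ler_pM2r.
have IE : farey_interval T h c = [set t | A (- h ^- 2 * t)].
  by apply/seteqP; split=> t /(farey_intervalE _ _ _ (lt0r_neq0 h0)).
have k0 : - h ^- 2 != 0 by rewrite oppr_eq0 invr_eq0 expf_neq0// gt_eqF.
split.
  rewrite IE.
  have mk : measurable_fun [set: R] (fun t => - h ^- 2 * t) by exact: measurable_funM.
  by have := mk measurableT A mA; rewrite setTI.
have := lebesgue_preimage_mul k0 mA.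
rewrite -IE /A lebesgue_shear_farey; last first.
  transitivity ((c 0 0)%:~R * (c 1 1)%:~R - (c 0 1)%:~R * (c 1 0)%:~R : R).
    by rewrite /x /x'; field; rewrite gt_eqF.
  by rewrite -!intrM -intrB -det_intmx22 dc.
rewrite normrN normfV ger0_norm ?exprn_ge0 ?(ltW h0)// => K.
by rewrite EFinM -K muleA -EFinM mulfV ?mul1e// expf_neq0// gt_eqF.
Qed.

End farey_horocycle.

(** The solutions (p, p') form an orbit under translation by (q, r); reducing p modulo q selects the
    one with p / q in [0, 1[. *)
Lemma coprime_basis (q r : nat) : (0 < q)%N -> coprime q r ->
  exists p p' : int, [/\ 0 <= p, p < q%:Z & q%:Z * p' - r%:Z * p = 1].
Proof.
move=> q0 cop; have [u [v]] := Bezoutz q r; rewrite /gcdz /= (eqP cop) => uv.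
have q0' : q%:Z != 0 by rewrite eqz_nat -lt0n.
exists ((- v) %% q%:Z)%Z, (u - r%:Z * ((- v) %/ q%:Z)%Z); split.
- exact: modz_ge0.
- by rewrite ltz_pmod.
- have := divz_eq (- v) q%:Z; set k := (_ %/ _)%Z; set p := (_ %% _)%Z => vE.
  have -> : p = - v - k * q%:Z by rewrite vE addrC addKr.
  by transitivity (u * q%:Z + v * r%:Z); [ring|rewrite uv].
Qed.

Lemma coprime_basis_uniq (q r p p' s s' : int) :
  q * p' - r * p = 1 -> q * s' - r * s = 1 ->
  0 <= p < q -> 0 <= s < q -> p = s /\ p' = s'.
Proof.
move=> dp ds /andP[p0 pq] /andP[s0 sq].
have cop : coprimez q r by apply/coprimezP; exists (p', - p) => /=; rewrite -dp; ring.
have E : q * (p' - s') = r * (p - s).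
  by apply/eqP; rewrite -subr_eq0; apply/eqP;
    transitivity ((q * p' - r * p) - (q * s' - r * s)); [ring|rewrite dp ds subrr].
have : (q %| p - s)%Z by rewrite -(Gauss_dvdzr _ cop) -E dvdz_mulr.
rewrite dvdzE => qps.
have ps : p = s.
  apply/eqP; rewrite -subr_eq0 -absz_eq0 -leqn0 leqNgt; apply/negP => ps0.
  by have := dvdn_leq ps0 qps; lia.
split=> //; have q_neq0 : q != 0 by rewrite gt_eqF// (le_lt_trans p0).
by move: E; rewrite ps subrr mulr0 => /eqP; rewrite mulf_eq0 (negbTE q_neq0) subr_eq0 => /eqP.
Qed.

Section farey_cover.
Variable R : realType.
Variables (T h : R) (N : nat).
Hypotheses (h_gt0 : 0 < h) (TN : T < h * N%:R).
Local Notation leb := (@lebesgue_measure R).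

Definition qmin_le_set : set R :=
  [set t | t \in `[0, 1] /\ h * (qmin t (h ^+ 2))%:R <= T].

Lemma qmin_leP t : h * (qmin t (h ^+ 2))%:R <= T <->
  exists c : 'M[int]_2, \det c = 1 /\ farey_interval T h c t.
Proof.
have h0 := lt0r_neq0 h_gt0.
have [[q0 [p pq]] qmin_lb] := minimumP 0%N (qmin_exists t (exprn_gt0 2 h_gt0)).
rewrite -/(qmin _ _) in q0 pq qmin_lb.
have dH : \det (horo h t) = 1 by rewrite det_mx22 !mxE /= mul0r subr0 divff.
have XE (a b : int) : horo h t 0 0 * a%:~R + horo h t 0 1 * b%:~R = h * a%:~R.
  by rewrite !mxE /= mul0r addr0.
have YE (a b : int) : horo h t 1 0 * a%:~R + horo h t 1 1 * b%:~R = (b%:~R - t * a%:~R) / h.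
  by rewrite !mxE /=; field.
have YX (a b : int) : 0 < a%:~R :> R -> (`|(b%:~R - t * a%:~R) / h| < h * a%:~R) =
    (b%:~R / a%:~R \in `]t - h ^+ 2, t + h ^+ 2[).
  move=> a0; rewrite in_itv /= -ltr_distlC distrC.
  have -> : (b%:~R - t * a%:~R) / h = (b%:~R / a%:~R - t) * (a%:~R / h).
    by field; rewrite h0 gt_eqF.
  rewrite normrM (gtr0_norm (divr_gt0 a0 h_gt0)) -ltr_pdivlMr ?divr_gt0//.
  by congr (_ < _); field; rewrite h0 gt_eqF.
split=> [qT|[c [dc /farey_vec[[a b] /=]]]].
  have q0R : 0 < (qmin t (h ^+ 2))%:R :> R by rewrite ltr0n.
  have [||c dc Fc] := @farey_exists _ T (horo h t) ((qmin t (h ^+ 2))%:Z, p) dH; last by exists c.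
    by rewrite XE /= mulr_gt0.
  by rewrite YE XE /= YX.
rewrite XE YE => -[/andP[ha aT] ya].
have a0 : 0 < a%:~R :> R by rewrite -(pmulr_rgt0 _ h_gt0).
have aE : a = `|a|%N%:Z by rewrite gez0_abs// ltW// -(ltr_int R).
apply: le_trans aT; rewrite ler_pM2l// aE -[leRHS]/((`|a|%N)%:R) ler_nat.
apply: qmin_lb; split; first by rewrite absz_gt0; apply: contraTneq a0 => ->; rewrite ltxx.
exists b; move: ya; rewrite YX// {1}aE.
by [].
Qed.

Lemma measurable_qmin_le_set : measurable qmin_le_set.
Proof.
rewrite (_ : qmin_le_set = `[0, 1]%classic `&`
    \bigcup_(c in [set c : 'M[int]_2 | \det c = 1]) farey_interval T h c); last first.
  apply/seteqP; split=> t [t01]; first by move/qmin_leP=> [c [dc ?]]; split=> //; exists c.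
  by move=> [c dc Fc]; split=> //; apply/qmin_leP; exists c.
apply: measurableI; first exact: measurable_itv.
rewrite bigcup_mkcond; apply: countable_bigcupT_measurable => // c.
case: ifPn => // /set_mem dc.
by have [] := lebesgue_farey_interval T h_gt0 dc.
Qed.

Let near_fraction (c : 'M[int]_2) t : farey_interval T h c t ->
  [/\ 0 < (c 0 0)%:~R :> R, 0 < (c 0 1)%:~R :> R, h * (c 0 0)%:~R <= T, h * (c 0 1)%:~R <= T &
      `|(c 1 0)%:~R / (c 0 0)%:~R - t| < h ^+ 2].
Proof.
move=> /(farey_intervalE _ _ _ (lt0r_neq0 h_gt0))[/andP[x0 xT] /andP[x'0 x'T] _ yx _].
have q0 : 0 < (c 0 0)%:~R :> R by rewrite -(pmulr_rgt0 _ h_gt0).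
split=> //; first by rewrite -(pmulr_rgt0 _ h_gt0).
move: yx.
have -> : (c 1 0)%:~R / h + - h ^- 2 * t * (h * (c 0 0)%:~R) =
    ((c 1 0)%:~R / (c 0 0)%:~R - t) * ((c 0 0)%:~R / h).
  by field; rewrite !gt_eqF.
rewrite normrM (gtr0_norm (divr_gt0 q0 h_gt0)) -ltr_pdivlMr ?divr_gt0//.
by move/lt_le_trans; apply; rewrite le_eqVlt; apply/orP; left; apply/eqP; field; rewrite !gt_eqF.
Qed.

Lemma lebesgue_qmin_le_set :
  (leb qmin_le_set <= (coprime_gap_sum T h N + 2 * h ^+ 2)%:E)%E /\
  ((coprime_gap_sum T h N)%:E <= leb qmin_le_set + (2 * h ^+ 2)%:E)%E.
Proof.
have h2 : 0 < h ^+ 2 by exact: exprn_gt0.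
(* One normalised matrix is chosen for each coprime pair; the matrix 0 is a dummy value for the
   others. *)
have /choice[B BP] : forall i : 'I_N * 'I_N, exists c : 'M[int]_2, (0 < i.1)%N -> coprime i.1 i.2 ->
    [/\ \det c = 1, c 0 0 = i.1%:Z, c 0 1 = i.2%:Z & 0 <= c 1 0 < i.1%:Z].
  move=> [q r] /=; have [q0|] := boolP (0 < q)%N; last by exists 0.
  have [cop|] := boolP (coprime q r); last by exists 0.
  have [p [p' [p0 pq d1]]] := coprime_basis q0 cop.
  exists (\matrix_(i, j) if i == 0 then if j == 0 then q%:Z else r%:Z
          else if j == 0 then p else p') => _ _.
  by rewrite det_intmx22 !mxE /= p0 pq.
pose P (i : 'I_N * 'I_N) := (0 < i.1)%N && coprime i.1 i.2.
pose F i := farey_interval T h (B i).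
pose U := \bigcup_(i in [set` P]) F i.
have detB i : P i -> \det (B i) = 1 by move=> /andP[i0 ic]; have [] := BP i i0 ic.
have mF i : P i -> measurable (F i).
  by move=> /detB Bi; have [] := lebesgue_farey_interval T h_gt0 Bi.
have mU : measurable U.
  rewrite /U bigcup_mkcond; apply: countable_bigcupT_measurable => // i.
  by case: ifPn => // /set_mem; exact: mF.
have lebU : leb U = (coprime_gap_sum T h N)%:E.
  rewrite /U measure_fin_bigcup//; last first.
  (* A common point t would have two Farey bases; they coincide, and their first row determines the
     pair. *)
  - move=> i j /= Pi Pj [t [Fi Fj]].
    have E : B i = B j by apply: farey_basis_uniq Fi Fj; exact: detB.
    have /andP[i0 ic] := Pi; have /andP[j0 jc] := Pj.
    have [_ i1 i2 _] := BP i i0 ic; have [_ j1 j2 _] := BP j j0 jc.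
    move: i j {Pi Pj i0 ic j0 jc Fi Fj} E i1 i2 j1 j2 => [i i'] [j j'] /= -> -> -> [ij] [ij'].
    by congr (_, _); exact/val_inj.
  rewrite -(@bigfs _ _ _ _ (index_enum ('I_N * 'I_N)%type) P (fun i => leb (F i))) ?index_enum_uniq//; last first.
    by move=> i _; rewrite mem_index_enum.
  rewrite (eq_bigr (fun i : 'I_N * 'I_N => (h ^+ 2 * gap_density T (h * i.1%:R) (h * i.2%:R))%:E)); last first.
    move=> i Pi; have [_ ->] := lebesgue_farey_interval T h_gt0 (detB i Pi).
    by have /andP[i0 ic] := Pi; have [_ -> -> _] := BP i i0 ic.
  rewrite sumEFin -mulr_sumr; congr (_ * _)%:E.
  rewrite pair_big_dep /= big_mkcond [RHS]big_mkcond; apply: eq_bigr => -[q r] _ /=.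
  rewrite /P /=; case: posnP => [->|//]; case: ifP => // _.
  by rewrite gap_density_out// mulr0 lexx.
(* As |p / q - t| < h^2, [E1] contains the t of [0, 1] whose fraction p / q is not in [0, 1[, and
   [E2] the t outside [0, 1] whose fraction is. *)
pose E1 : set R := `[0, h ^+ 2]%classic `|` `[1 - h ^+ 2, 1]%classic.
pose E2 : set R := `[- h ^+ 2, 0]%classic `|` `[1, 1 + h ^+ 2]%classic.
have mE1 : measurable E1 by apply: measurableU; exact: measurable_itv.
have mE2 : measurable E2 by apply: measurableU; exact: measurable_itv.
have leb_itv (a b : R) : a < b -> leb `[a, b]%classic = (b - a)%:E.
  by move=> ab; rewrite lebesgue_measure_itv /= lte_fin ab EFinB.
have leb_two_itv (a b c d : R) : a < b -> c < d ->
    (leb (`[a, b]%classic `|` `[c, d]%classic) <= (b - a + (d - c))%:E)%E.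
  move=> ab cd; rewrite EFinD -(leb_itv _ _ ab) -(leb_itv _ _ cd).
  by apply: measureU2; exact: measurable_itv.
have lebE1 : (leb E1 <= (2 * h ^+ 2)%:E)%E.
  by apply: (le_trans (leb_two_itv _ _ _ _ _ _)); [..|rewrite lee_fin]; lra.
have lebE2 : (leb E2 <= (2 * h ^+ 2)%:E)%E.
  by apply: (le_trans (leb_two_itv _ _ _ _ _ _)); [..|rewrite lee_fin]; lra.
split.
  have SU : qmin_le_set `<=` U `|` E1.
    move=> t [/[!in_itv]/= /andP[t0 t1] /qmin_leP[c [dc Fc]]].
    have [q0 r0 qT rT /ltr_normlP[n1 n2]] := near_fraction Fc.
    have [p_lt0|p0] := ltP (c 1 0) 0.
      right; left; rewrite /= in_itv /= t0 /=.
      have : (c 1 0)%:~R / (c 0 0)%:~R < 0 :> R by rewrite ltr_pdivrMr// mul0r ltrz0.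
      lra.
    have [qp|pq] := leP (c 0 0) (c 1 0).
      right; right; rewrite /= in_itv /= t1 andbT.
      have : 1 <= (c 1 0)%:~R / (c 0 0)%:~R :> R by rewrite ler_pdivlMr// mul1r ler_int.
      lra.
    left.
    have lt_N (z : int) : 0 < z%:~R :> R -> h * z%:~R <= T -> z = `|z|%N%:Z /\ (`|z| < N)%N.
      rewrite ltr0z => z0 zT; have zE : z = `|z|%N%:Z by rewrite gez0_abs// ltW.
      split=> //; have := le_lt_trans zT TN; rewrite ltr_pM2l// {1}zE.
      by rewrite -[X in X < _]/((`|z|%N)%:R) ltr_nat.
    have [qE qN] := lt_N _ q0 qT; have [rE rN] := lt_N _ r0 rT.
    have dc' := dc; rewrite det_intmx22 in dc'.
    pose i : 'I_N * 'I_N := (Ordinal qN, Ordinal rN).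
    have ic : coprime i.1 i.2.
      rewrite -coprimezE; apply/coprimezP; exists (c 1 1, - c 1 0) => /=.
      by rewrite -dc'; ring.
    have i0 : (0 < i.1)%N by rewrite /= absz_gt0 gt_eqF// -(ltr0z R).
    have [dB B00 B01 B10] := BP i i0 ic.
    exists i; first exact/andP.
    rewrite /F (_ : B i = c)//.
    rewrite /= -qE in B00 B10; rewrite /= -rE in B01.
    rewrite det_intmx22 B00 B01 in dB.
    have [|B10E B11E] := coprime_basis_uniq dB dc' B10; first by rewrite p0 pq.
    exact: matrix22P.
  apply: (@le_trans _ _ (leb (U `|` E1))).
    apply: le_measure => //; rewrite inE; first exact: measurable_qmin_le_set.
    exact: measurableU.
  apply: (@le_trans _ _ (leb U + leb E1)%E); first exact: measureU2.
  by rewrite EFinD -lebU leeD2l.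
rewrite -lebU.
have US : U `<=` qmin_le_set `|` E2.
  move=> t [i Pi Ft]; have /andP[i0 ic] := Pi.
  have [_ B00 B01 /andP[B10 B10i]] := BP i i0 ic.
  have [q0 _ _ _ nt] := near_fraction Ft.
  have f0 : 0 <= (B i 1 0)%:~R / (B i 0 0)%:~R :> R by apply: divr_ge0; [rewrite ler0z|exact: ltW].
  have f1 : (B i 1 0)%:~R / (B i 0 0)%:~R < 1 :> R by rewrite ltr_pdivrMr// mul1r ltr_int B00.
  move: nt; rewrite ltr_norml => /andP[n1 n2].
  have [t0|t0] := ltP t 0.
    by right; left; rewrite /= in_itv /=; apply/andP; split; lra.
  have [t1|t1] := ltP 1 t.
    by right; right; rewrite /= in_itv /=; apply/andP; split; lra.
  left; split; first by rewrite in_itv /= t0 t1.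
  by apply/qmin_leP; exists (B i); split=> //; exact: detB.
apply: (@le_trans _ _ (leb (qmin_le_set `|` E2))).
  apply: le_measure => //; rewrite inE//.
  by apply: measurableU => //; exact: measurable_qmin_le_set.
apply: (@le_trans _ _ (leb qmin_le_set + leb E2)%E).
  by apply: measureU2 => //; exact: measurable_qmin_le_set.
by rewrite leeD2l.
Qed.

End farey_cover.

(** * Dirichlet's theorem and the control of the total mass *)

(** Two fractions p / q < t <= p' / q' are found with q + q' > T / h and q (p' - t q') + q' (t q -
    p) = 1. The larger denominator exceeds T / (2 h), so the other fraction has numerator error
    below 2 h / T. *)
Lemma dirichlet (R : realType) (T h t : R) :
  0 < T -> 0 < h -> h <= T -> 0 <= t -> t <= 1 ->
  exists (a : nat) (b : int),
    [/\ (0 < a)%N, h * a%:R <= T & `|b%:~R - t * a%:R| < 2 * h / T].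
Proof.
move=> T_gt0 h_gt0 hT t0 t1.
have d1 : 1 * 1 - 0 * (- t) = 1 :> R by rewrite mul0r subr0 mulr1.
have nat_of (z : int) : 0 < z%:~R :> R -> exists2 a : nat, (0 < a)%N & z%:~R = a%:R :> R.
  rewrite ltr0z => z0; exists `|z|%N; first by rewrite absz_gt0 gt_eqF.
  by rewrite -{1}(gez0_abs (ltW z0)).
(* In the lattice of the vectors (q, p - t q), the starting vector (1, -1) has slope -1 - t, which
   lies in [-2, 0[ as 0 <= t <= 1; tau = 0 separates the fractions below t from the others. *)
have [||u [v [uv]]] := @exists_next_basis R _ _ _ _ d1 (T / h) (-2) 0 (1, -1).
- by rewrite /= mul1r mul0r addr0 ltr01 ler_pdivlMr// mul1r.
- have m1 : (-1)%:~R = -1 :> R by rewrite mulrNz.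
  rewrite /= m1 (mulr1z 1). rewrite !(mul1r, mulr1, mul0r, addr0); apply/andP; split; lra.
rewrite !mul0r !mul1r !addr0.
set q : R := u.1%:~R; set p : R := u.2%:~R; set q' : R := v.1%:~R; set p' : R := v.2%:~R.
move=> /andP[q0 qT] /andP[q'0 q'T] Tqq [/andP[_ pn] p'n].
have dR : q * (- t * q' + p') + q' * (t * q - p) = 1.
  transitivity (q * p' - q' * p); first by ring.
  by rewrite /q /q' /p /p' -!intrM -intrB uv.
have bound (x y z : R) : 0 < x -> 0 <= z -> z * x <= 1 -> T / h < 2 * x -> z < 2 * h / T.
  move=> x0 z0 zx; rewrite ltr_pdivrMr// => Tx.
  rewrite ltr_pdivlMr//; apply: (@le_lt_trans _ _ (z * x * (T / x))).
    by rewrite le_eqVlt; apply/orP; left; apply/eqP; field; rewrite gt_eqF.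
  apply: (@le_lt_trans _ _ (1 * (T / x))); first by rewrite ler_wpM2r// divr_ge0// ltW.
  by rewrite mul1r ltr_pdivrMr//; lra.
have qy : 0 <= q * (- t * q' + p') by rewrite mulr_ge0// ltW.
have qy' : 0 <= q' * (t * q - p) by rewrite mulr_ge0//; [exact: ltW|lra].
have [qq'|q'q] := leP q q'.
  have [a a0 aE] := nat_of _ q0; exists a, u.2; rewrite -aE -/q -/p; split=> //.
    by rewrite mulrC -ler_pdivlMr.
  rewrite distrC ger0_norm; last by lra.
  by apply: (bound q') => //; [lra|rewrite mulrC; lra|lra].
have [a a0 aE] := nat_of _ q'0; exists a, v.2; rewrite -aE -/q' -/p'; split=> //.
  by rewrite mulrC -ler_pdivlMr.
rewrite ger0_norm; last by lra.
by apply: (bound q) => //; [lra|rewrite mulrC; lra|lra].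
Qed.

Section law_normalization.
Variable R : realType.
Local Notation leb := (@lebesgue_measure R).

(** Dirichlet gives a <= T / h and |b - t a| < 2 h / T. If t is exceptional, a is not among its
    denominators, so h^2 a <= |b - t a| and a < 2 / (h T). Such t lie in balls of length 4 h / (T a)
    around b / a with 0 <= b <= a, at most 8 h / T for each a. In [I] the denominator is shifted by
    one. *)
Lemma qmin_le_set_compl (T h : R) : 0 < T -> 0 < h -> h <= T / 2 ->
  (leb (`[0%R, 1%R] `\` qmin_le_set T h) <= (16 / T ^+ 2)%:E)%E.
Proof.
move=> T0 h0 hT.
have hT' : h <= T by lra.
pose K := Num.truncn (2 / (h * T)).
pose I (a b : nat) : set R := ball (b%:R / a.+1%:R : R) (2 * h / T / a.+1%:R).
have sub : [set` `[0, 1]] `\` qmin_le_set T h `<=`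
    \big[setU/set0]_(a < K) \big[setU/set0]_(b < a.+2) I a b.
  move=> t [/=]; rewrite in_itv /= => /andP[t0 t1] nS.
  have [a [b [a0 aT abt]]] := dirichlet T0 h0 hT' t0 t1.
  have [q0 qlb] := minimumP 0%N (qmin_exists t (exprn_gt0 2 h0)).
  have aR : 0 < a%:R :> R by rewrite ltr0n.
  have aN := lt0r_neq0 aR.
  have a_le : h ^+ 2 * a%:R <= `|b%:~R - t * a%:R|.
    rewrite leNgt; apply/negP => lt_h2a; apply: nS; split; first by rewrite in_itv /= t0.
    apply: (le_trans _ aT); rewrite ler_wpM2l ?(ltW h0)// ler_nat -leEnat; apply: qlb.
    split=> //; exists b; move: lt_h2a; rewrite -ltr_pdivrMr//.
    have -> : `|b%:~R - t * a%:R| / a%:R = `|b%:~R / a%:R - t|.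
      by rewrite -{2}(mulfK aN t) -mulrBl normrM normfV (gtr0_norm aR).
    by rewrite distrC ltr_distlC in_itv.
  have hT2 : 2 * h / T <= 1 by rewrite ler_pdivrMr//; lra.
  have /andP[b0 ba] : 0 <= b <= a%:Z.
    move: abt; rewrite ltr_norml => /andP[n1 n2].
    have ta0 : 0 <= t * a%:R by rewrite mulr_ge0// ltW.
    have ta1 : t * a%:R <= a%:R by rewrite ler_piMl// ltW.
    have b1 : -1 < b%:~R :> R by lra.
    have b2 : b%:~R < (a%:Z + 1)%:~R :> R by rewrite intrD /=; lra.
    move: b1 b2; rewrite -(intrN R 1) !ltr_int; clear; lia.
  have aK : (a <= K)%N.
    rewrite truncn_ge_nat; last by rewrite divr_ge0 ?mulr_ge0 ?(ltW h0) ?(ltW T0).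
    have := le_lt_trans a_le abt; rewrite ltr_pdivlMr// => aT2.
    rewrite ler_pdivlMr ?mulr_gt0//; apply: ltW.
    rewrite -(ltr_pM2l h0) (mulrC h 2).
    by have -> : h * (a%:R * (h * T)) = h ^+ 2 * a%:R * T by ring.
  case: a a0 aR aN aT abt a_le ba aK => // a _ aR aN aT abt a_le ba aK.
  case: b abt a_le b0 ba => // b abt _ _ ba.
  rewrite -(bigcup_mkord K (fun a => \big[setU/set0]_(b < a.+2) I a b)); exists a => //=.
  rewrite -(bigcup_mkord a.+2 (I a)); exists b; first by move: ba; clear; rewrite /=; lia.
  rewrite /I /ball /= ltr_pdivlMr// -[X in _ * X < _](gtr0_norm aR) -normrM mulrBl mulfVK//.
have leI a b : leb (I a b) = (4 * h / T / a.+1%:R)%:E.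
  rewrite lebesgue_measure_ball; last by rewrite !divr_ge0 ?mulr_ge0 ?(ltW h0) ?(ltW T0).
  by congr EFin; rewrite -mulr_natl; ring.
have mI a b : measurable (I a b) by exact: measurable_ball.
apply: (@le_trans _ _ (leb (\big[setU/set0]_(a < K) \big[setU/set0]_(b < a.+2) I a b))).
  apply: le_measure => //; rewrite inE.
    by apply: measurableD; [exact: measurable_itv|exact: measurable_qmin_le_set].
  by do 2 apply: bigsetU_measurable => ? _; exact: mI.
apply: (@le_trans _ _ (\sum_(a < K) (8 * h / T)%:E)%E).
  apply: le_trans; first apply: (@Boole_inequality _ _ _ leb (fun a => \big[setU/set0]_(b < a.+2) I a b)).
    by move=> a _ /=; apply: bigsetU_measurable => b _; exact: mI.
  apply: lee_sum => a _.
  apply: le_trans; first by apply: (@Boole_inequality _ _ _ leb (I a)) => b _; exact: mI.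
  rewrite (eq_bigr (fun=> (4 * h / T / a.+1%:R)%:E)); last by move=> b _; exact: leI.
  rewrite sumEFin lee_fin sumr_const card_ord -[leLHS]mulr_natl.
  have -> : 8 * h / T = 2 * a.+1%:R * (4 * h / T / a.+1%:R).
    by field; rewrite nat1r pnatr_eq0 (lt0r_neq0 T0).
  apply: ler_wpM2r; first by rewrite !divr_ge0 ?mulr_ge0 ?(ltW h0) ?(ltW T0).
  by rewrite -natrM ler_nat; lia.
rewrite sumEFin lee_fin sumr_const card_ord -[leLHS]mulr_natl.
apply: (@le_trans _ _ (2 / (h * T) * (8 * h / T))).
  apply: ler_wpM2r; first by rewrite divr_ge0 ?mulr_ge0 ?(ltW h0) ?(ltW T0).
  by rewrite truncn_le divr_ge0 ?mulr_ge0 ?(ltW h0) ?(ltW T0).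
rewrite le_eqVlt; apply/orP; left; apply/eqP; field.
by rewrite !gt_eqF.
Qed.

End law_normalization.

(** * The limit law, its total mass and the conclusion *)

Section law_limit.
Variable R : realType.
Local Notation leb := (@lebesgue_measure R).

Definition farey_law (T : R) : R := fine (gap_integral T) / limn (@inv_sq_sum R).

Let lebesgue_unit : leb [set` `[0, 1]] = 1%:E.
Proof.
transitivity (if (0 : \bar R) < 1 then (1 : \bar R) - 0 else 0)%E.
  exact: (lebesgue_measure_itv (Interval (BLeft (0 : R)) (BRight 1))).
by rewrite lte_fin ltr01 sube0.
Qed.

Lemma lebesgue_qmin_le_set_fin_num (T h : R) : 0 < h ->
  leb (qmin_le_set T h) \is a fin_num.
Proof.
move=> h0; rewrite ge0_fin_numE//; apply: (@le_lt_trans _ _ (leb [set` `[0, 1]])).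
  apply: le_measure; rewrite ?inE; first exact: measurable_qmin_le_set.
    exact: measurable_itv.
  by move=> t [].
have -> : leb [set` `[0, 1]] = 1%:E by exact: lebesgue_unit.
exact: ltry.
Qed.

Lemma qmin_le_set_cvg (T e : R) : 0 < T -> 0 < e ->
  exists2 d, 0 < d & forall h, 0 < h -> h < d ->
    `|fine (leb (qmin_le_set T h)) - farey_law T| < e.
Proof.
move=> T0 e0; have [d d0 dP] := @coprime_gap_sum_cvg R T T0 (e / 2) (divr_gt0 e0 (ltr0Sn _ 1)).
(* The cap 1 gives h^2 <= h; with h < e / 4 the boundary term 2 h^2 is below e / 2. *)
exists (Num.min d (Num.min 1 (e / 4))); first by rewrite !lt_min d0 ltr01 divr_gt0.
move=> h h0; rewrite !lt_min => /and3P[hd h1 he].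
have TN : T < h * (Num.truncn (T / h)).+1%:R.
  by rewrite mulrC -ltr_pdivrMr//; exact: truncnS_gt.
have := dP h _ h0 hd TN; have [] := lebesgue_qmin_le_set h0 TN.
rewrite -(fineK (lebesgue_qmin_le_set_fin_num T h0)) -EFinD !lee_fin.
have h2h : h ^+ 2 <= h by rewrite expr2 ler_piMl// ltW.
rewrite -/(farey_law T) !ltr_norml => s1 s2 /andP[n1 n2].
by apply/andP; split; lra.
Qed.

Lemma farey_law_le1 (T : R) : 0 < T -> farey_law T <= 1.
Proof.
move=> T0; apply/ler_addgt0Pr => e e0.
have [d d0 dP] := qmin_le_set_cvg T0 e0.
have h0 : 0 < d / 2 by rewrite divr_gt0.
have := dP _ h0; rewrite ltr_pdivrMr// ltr_pMr// ltr1n => /(_ isT).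
have : fine (leb (qmin_le_set T (d / 2))) <= 1.
  rewrite -lee_fin fineK; last exact: lebesgue_qmin_le_set_fin_num.
  have <- : leb [set` `[0, 1]] = 1%:E by exact: lebesgue_unit.
  apply: le_measure; rewrite ?inE; first exact: measurable_qmin_le_set.
    exact: measurable_itv.
  by move=> t [].
by rewrite ltr_norml => s1 /andP[n1 n2]; lra.
Qed.

(** The bound of [qmin_le_set_compl] does not depend on h, so it survives the limit h -> 0. *)
Lemma farey_law_ge (T : R) : 0 < T -> 1 - 16 / T ^+ 2 <= farey_law T.
Proof.
move=> T0; apply/ler_addgt0Pr => e e0.
have [d d0 dP] := qmin_le_set_cvg T0 e0.
pose h := Num.min d T / 2.
have m0 : 0 < Num.min d T by rewrite lt_min d0.
have h0 : 0 < h by rewrite divr_gt0.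
have hd : h < d by rewrite ltr_pdivrMr//; have : Num.min d T <= d by [rewrite ge_min lexx]; lra.
have hT : h <= T / 2 by rewrite ler_wpM2r ?invr_ge0// ge_min lexx orbT.
have := dP _ h0 hd.
have : 1 <= fine (leb (qmin_le_set T h)) + 16 / T ^+ 2.
  rewrite -lee_fin EFinD fineK; last exact: lebesgue_qmin_le_set_fin_num.
  have <- : leb [set` `[0, 1]] = 1%:E by exact: lebesgue_unit.
  apply: (@le_trans _ _ (leb (qmin_le_set T h) + leb ([set` `[0%R, 1%R]] `\` qmin_le_set T h))%E).
    have mq : measurable (qmin_le_set T h) by exact: measurable_qmin_le_set.
    have mi : measurable [set` `[0%R : R, 1%R]] by exact: measurable_itv.
    have {1}-> : [set` `[0, 1]] = qmin_le_set T h `|` ([set` `[0, 1]] `\` qmin_le_set T h).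
      by rewrite setDE setUIr setUv setIT; apply/esym/setUidPr => t [].
    apply: measureU2 => //; exact: measurableD.
  by rewrite leeD2l// qmin_le_set_compl.
by rewrite ltr_norml => s1 /andP[n1 n2]; lra.
Qed.

Lemma farey_law_cvg1 : farey_law n.+1%:R @[n --> \oo] --> (1 : R).
Proof.
apply: (@squeeze_cvgr _ _ _ _ (fun n : nat => 1 - 16 * harmonic n) (fun=> 1)).
- near=> n; have n0 : 0 < n.+1%:R :> R by [].
  rewrite farey_law_le1// andbT; apply: le_trans (farey_law_ge n0).
  rewrite lerD2l lerN2 ler_wpM2l// expr2 invfM ler_piMl//.
  by rewrite invf_le1// ler1n.
- rewrite -[X in _ --> X]subr0 -[X in _ - X](mulr0 16); apply: cvgB; first exact: cvg_cst.
  by apply: cvgMr; exact: cvg_harmonic.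
- exact: cvg_cst.
Unshelve. all: by end_near. Qed.

Lemma F11_law (mu2 : probability (borelX2 R) R) (mu2_inv : SL2_invariant mu2) (T : R) :
  0 < T -> mu2 [set L : borelX2 R | F11 L <= T] = (farey_law T)%:E.
Proof.
move=> T0; pose S (t : R) := [set L : borelX2 R | F11 L <= t].
have mS t : measurable (S t) by exact: measurable_F11_le.
have fS t : mu2 (S t) \is a fin_num by exact: fin_num_measure.
rewrite -[LHS](fineK (fS T)); congr EFin.
have cross (a b c d : \bar R) : a \is a fin_num -> b \is a fin_num ->
    c \is a fin_num -> d \is a fin_num -> (a * d = b * c)%E ->
    fine a * (fine d / limn (@inv_sq_sum R)) = fine b * (fine c / limn (@inv_sq_sum R)).
  by move=> fa fb fc fd abcd; rewrite !mulrA -!fineM// abcd.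
have prop t : fine (mu2 (S T)) * farey_law t = fine (mu2 (S t)) * farey_law T.
  exact: (cross _ _ _ _ (fS T) (fS t) (gap_integral_fin_num T) (gap_integral_fin_num t)
    (@F11_law_proportional R mu2 mu2_inv T t)).
have m1 : fine (mu2 (S n.+1%:R)) @[n --> \oo] --> (1 : R).
  have : mu2 (S n.+1%:R) @[n --> \oo] --> mu2 (\bigcup_n S n.+1%:R).
    apply: nondecreasing_cvg_mu => //; first exact: bigcup_measurable.
    apply/nondecreasing_seqP => n; apply/subsetPset => L /= /le_trans; apply.
    by rewrite ler_nat.
  have -> : \bigcup_n S n.+1%:R = setT.
    apply/seteqP; split=> // L _; exists (Num.truncn (F11 L)) => //.
    exact/ltW/truncnS_gt.
  by rewrite probability_setT => /fine_cvgP[].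
have l1 : fine (mu2 (S T)) * farey_law n.+1%:R @[n --> \oo] --> fine (mu2 (S T)).
  rewrite -[X in _ --> X]mulr1; apply: cvgMr; exact: farey_law_cvg1.
have l2 : fine (mu2 (S T)) * farey_law n.+1%:R @[n --> \oo] --> farey_law T.
  rewrite -[X in _ --> X]mul1r (_ : (fun n : nat => _) = (fun n : nat => fine (mu2 (S n.+1%:R)) * farey_law T)).
    exact: cvgMl.
  by apply/funext => n; exact: prop.
exact: (cvg_unique _ l1 l2).
Qed.

End law_limit.

Theorem theorem1p2 (R : realType) (mu2 : probability (borelX2 R) R)
    (mu2_inv : SL2_invariant mu2) (T : R) (T_gt0 : 0 < T) :
  lebesgue_measure [set x : R | x \in `[0, 1] /\
      Num.sqrt delta * (qmin x delta)%:R <= T] @[delta --> 0^'+]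
    --> mu2 [set L : borelX2 R | F11 L <= T].
Proof.
rewrite F11_law//.
have setE delta : 0 < delta -> [set x : R | x \in `[0, 1] /\
    Num.sqrt delta * (qmin x delta)%:R <= T] = qmin_le_set T (Num.sqrt delta).
  by move=> d0; rewrite /qmin_le_set sqr_sqrtr// ltW.
apply/fine_cvgP; split.
  near=> delta; have d0 : 0 < delta by near: delta; exact: nbhs_right_gt.
  by rewrite setE// lebesgue_qmin_le_set_fin_num// sqrtr_gt0.
apply/cvgrPdist_lt => e e0; have [d d0 dP] := qmin_le_set_cvg T_gt0 e0.
near=> delta; have delta0 : 0 < delta by near: delta; exact: nbhs_right_gt.
have delta_lt : delta < d ^+ 2 by near: delta; apply: nbhs_right_lt; exact: exprn_gt0.
rewrite /= setE// distrC; apply: dP; first by rewrite sqrtr_gt0.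
by rewrite -(ltr_pXn2r (ltn0Sn 1)) ?nnegrE ?sqrtr_ge0 ?sqr_sqrtr// ltW.
Unshelve. all: by end_near. Qed.
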